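(* Let $n\ge1$ and let $\alpha\in(0,n+2)$, $\lambda$, $\sigma$ be constants with $\lambda\ge\frac{n+2}{n}$ and $0\le\sigma<1-\frac{\alpha-2}{n+2}\lambda$. Suppose $u$ is a nonnegative function with $u\in C^{2,1}(\mathbb{R}^n\times(0,16))\cap L^\lambda(\mathbb{R}^n\times(0,16))$ satisfying $$0\le u_t-\Delta u\le \Big(\iint_{\mathbb{R}^n\times(0,16)}\Phi(x-y,t-s)^{\alpha/n}u(y,s)^\lambda\,dy\,ds\Big)\,u(x,t)^\sigma\quad\text{in }B_4(0)\times(0,16).$$ Then $\max_{|x|\le1}u(x,t)=o\big(t^{-\frac{n+2}{2\lambda}}\big)$ as $t\to0^+$.
   Context: $\Phi$ is the heat kernel: $\Phi(x,t)=(4\pi t)^{-n/2}e^{-|x|^2/(4t)}$ for $t>0$ and $\Phi(x,t)=0$ for $t\le0$. $B_r(0)$ is the open ball of radius $r$ centered at the origin of $\mathbb{R}^n$. *)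

(* Defs.v *)
From HB Require Import structures.
From mathcomp Require Import all_boot all_order all_algebra.
From mathcomp Require Import all_classical all_reals all_analysis.
Set Implicit Arguments. Unset Strict Implicit. Unset Printing Implicit Defensive.
Import Order.TTheory GRing.Theory Num.Theory.
Import numFieldNormedType.Exports.
Local Open Scope classical_set_scope.
Local Open Scope ring_scope.

(* Points of R^n are row vectors 'rV[R]_n.  NB: the library norm on 'rV is the
   sup norm, so we define the Euclidean norm explicitly. *)
Definition enorm {R : realType} {n : nat} (x : 'rV[R]_n) : R :=
  Num.sqrt (\sum_(i < n) x ord0 i ^+ 2).

Definition heat_kernel {R : realType} {n : nat} (x : 'rV[R]_n) (t : R) : R :=
  if 0 < t then powR (4 * pi * t) (- (n%:R / 2)) * expR (- (enorm x ^+ 2) / (4 * t))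
  else 0.

(* Lebesgue integral over R^n of a (nonnegative) extended-real function, as an
   iterated integral over the coordinates (Tonelli). *)
Fixpoint int_Rn {R : realType} (n : nat) : ('rV[R]_n -> \bar R) -> \bar R :=
  match n with
  | 0 => fun f => f 0
  | m.+1 => fun f =>
      (\int[@lebesgue_measure R]_(a in setT)
          int_Rn (fun v : 'rV[R]_m => f (row_mx (a%:M : 'rV[R]_1) v)))%E
  end.

Definition int_slab {R : realType} (n : nat) (f : 'rV[R]_n -> R -> \bar R) : \bar R :=
  (\int[@lebesgue_measure R]_(s in `]0%R, 16%R[) int_Rn (fun y => f y s))%E.

Definition evec {R : realType} {n : nat} (i : 'I_n) : 'rV[R]_n := delta_mx 0 i.

Definition dx {R : realType} {n : nat} (u : 'rV[R]_n -> R -> R) (i : 'I_n) :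
  'rV[R]_n -> R -> R := fun x t => 'D_(evec i) (fun y => u y t) x.

Definition dt {R : realType} {n : nat} (u : 'rV[R]_n -> R -> R) :
  'rV[R]_n -> R -> R := fun x t => 'D_1 (u x) t.

Definition laplacian {R : realType} {n : nat} (u : 'rV[R]_n -> R -> R) :
  'rV[R]_n -> R -> R := fun x t => \sum_(i < n) dx (dx u i) i x t.

Definition jcont {R : realType} {n : nat} (f : 'rV[R]_n -> R -> R) x t :=
  {for (x, t), continuous (fun p : 'rV[R]_n * R => f p.1 p.2)}.

Definition C21_slab {R : realType} {n : nat} (u : 'rV[R]_n -> R -> R) : Prop :=
  forall x t, 0 < t < 16 ->
  [/\ jcont u x t,
      derivable (u x) t 1 /\ jcont (dt u) x t,
      (forall i, derivable (fun y => u y t) x (evec i) /\ jcont (dx u i) x t) &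
      (forall i j, derivable (fun y => dx u i y t) x (evec j) /\
                   jcont (dx (dx u i) j) x t)].

Definition Llambda_slab {R : realType} {n : nat} (lambda : R)
  (u : 'rV[R]_n -> R -> R) : Prop :=
  (int_slab (fun y s => (powR `|u y s| lambda)%:E) < +oo)%E.

Definition max_unit_ball {R : realType} {n : nat} (u : 'rV[R]_n -> R -> R) (t : R) : R :=
  sup [set u x t | x in [set x : 'rV[R]_n | enorm x <= 1]].

(* Main.v *)
(** A blow-up argument resting only on the maximum principle. Put
    gamma = (n + 2) / lambda. If t^(gamma/2) u(x, t) > e for some small t, a
    doubling argument gives a backward parabolic cylinder of radius r, small
    with t, at whose top centre u equals a value M with r^gamma M constant, and
    on which u <= k M. Splitting the potential into the part inside a cylinder
    of radius comparable to r (where u <= k M and the power of the kernel is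
    integrable, as alpha < n + 2) and the part outside (where that power of the
    kernel is at most C r^-alpha) bounds it by C r^-alpha; the hypothesis on
    sigma then says exactly that u_t - Laplacian u <= k M / r^2 for small r.
    Comparison with reflections of u and with quadratic barriers now yields
    u >= M / 4 on a smaller cylinder of comparable size, so the integral of
    u^lambda over the time interval (0, t) is at least
    c M^lambda r^(n+2), a positive constant: impossible as t tends to 0, since
    u is in L^lambda. *)

Require Import Defs.
From HB Require Import structures.
From mathcomp Require Import all_boot all_order all_algebra.
From mathcomp Require Import all_classical all_reals all_analysis.
From mathcomp Require Import measurable_realfun ring lra.
Import Order.TTheory GRing.Theory Num.Theory.
Import numFieldNormedType.Exports.
Local Open Scope classical_set_scope.
Local Open Scope ring_scope.

(** * Integrals of functions that need not be measurable *)

(** The crux is to bound u from below backward in time. The inequality u_t - Laplacian u >= 0 alone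
    spreads positivity forward only and would let u jump up to M at the last moment; it is the upper
    bound of the source at the natural scale M / r^2 that forbids such a jump, and the doubling and
    the potential estimate serve to reach that scale. The two bounds on a cylinder of radius r, k M
    for u and k M / r^2 for the source, keep their form under parabolic rescaling, so explicit
    quadratic polynomials suffice for the comparison, and the fraction [th] of the cylinder that
    they yield depends on n and k only. With this gamma, M^lambda r^(n+2) is determined by r^gamma
    M: the mass found does not depend on where, or at which scale, the cylinder lies. Hence a time
    interval carrying at most half of that mass can be fixed before the cylinder is known. *)

Section lower_integral.
Local Open Scope ereal_scope.
Context {d : measure_display} {T : measurableType d} {R : realType}.
Variable mu : {measure set T -> \bar R}.
Implicit Types (D E : set T) (f g B : T -> \bar R).
Import HBNNSimple.

(* The integral of a nonnegative function is a supremum over the simple functions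
   below it, so these one-sided rules hold without measurability (suffix [_nm]);
   thus no measurability of [u] or of its iterated integrals is ever needed. *)
Lemma ge0_le_integral_nm D E f g :
  (forall x, D x -> 0 <= f x) -> (forall x, E x -> 0 <= g x) ->
  (forall x, D x -> E x /\ f x <= g x) ->
  \int[mu]_(x in D) f x <= \int[mu]_(x in E) g x.
Proof.
move=> f0 g0 fg; rewrite !ge0_integralE//.
apply: le_ereal_sup => _ [h /= hf <-]; exists h => //= x.
apply: (le_trans (hf x)); rewrite /patch; case: ifPn => [|_].
  by rewrite inE => Dx; have [Ex fgx] := fg _ Dx; rewrite mem_set.
by case: ifPn => //; rewrite inE => /g0.
Qed.

(** The supremum runs over simple functions below [f] extended by zero; nonnegativity forces them to
    vanish off [D], so only measurable minorants on [D] have to be tested. *)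
Lemma ge0_integral_ub_nm D f (M : \bar R) : measurable D ->
  (forall x, D x -> 0 <= f x) ->
  (forall h : T -> R, measurable_fun setT h -> (forall x, (0 <= h x)%R) ->
    (forall x, D x -> (h x)%:E <= f x) -> \int[mu]_(x in D) (h x)%:E <= M) ->
  \int[mu]_(x in D) f x <= M.
Proof.
move=> mD f0 H; rewrite ge0_integralE//.
apply: ge_ereal_sup => _ [h /= hf <-].
rewrite -integralT_nnsfun.
have -> : \int[mu]_x (h x)%:E = \int[mu]_(x in D) (h x)%:E.
  rewrite [RHS]integral_mkcond; apply: eq_integral => x _.
  rewrite /patch; case: ifPn => // nDx; have := hf x.
  rewrite /patch (negbTE nDx) lee_fin => h0.
  by apply: congr1; apply/eqP; rewrite eq_le h0/=.
apply: H => // x Dx; have := hf x.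
by rewrite /patch mem_set.
Qed.

Lemma ge0_integralD_EFin D (f g : T -> R) : measurable D ->
  measurable_fun D f -> measurable_fun D g ->
  (forall x, D x -> (0 <= f x)%R) -> (forall x, D x -> (0 <= g x)%R) ->
  \int[mu]_(x in D) ((f x)%:E + (g x)%:E) =
  \int[mu]_(x in D) (f x)%:E + \int[mu]_(x in D) (g x)%:E.
Proof.
move=> mD /measurable_EFinP mf /measurable_EFinP mg f0 g0.
by apply: ge0_integralD => // x Dx; rewrite lee_fin ?f0 ?g0.
Qed.

Lemma ge0_integralZl_EFinr D (c : R) (f : T -> R) : measurable D ->
  measurable_fun D f -> (forall x, D x -> (0 <= f x)%R) -> (0 <= c)%R ->
  \int[mu]_(x in D) (c * f x)%:E = c%:E * \int[mu]_(x in D) (f x)%:E.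
Proof.
move=> mD /measurable_EFinP mf f0 c0.
by rewrite -(ge0_integralZl_EFin _ mD _ mf)// => x Dx; rewrite lee_fin f0.
Qed.

(** Lower integrals are superadditive but in general not subadditive; measurability of one summand
    restores the bound. For a measurable minorant [h] of [G + B], the positive part of [h - G] is a
    measurable minorant of [B], and [h] is at most [G] plus it. *)
Lemma ge0_integralD_le_nm D (G : T -> R) B : measurable D ->
  measurable_fun D G -> (forall x, D x -> (0 <= G x)%R) ->
  (forall x, D x -> 0 <= B x) ->
  \int[mu]_(x in D) ((G x)%:E + B x) <=
  \int[mu]_(x in D) (G x)%:E + \int[mu]_(x in D) B x.
Proof.
move=> mD mG G0 B0; apply: ge0_integral_ub_nm => //.
  by move=> x Dx; rewrite adde_ge0 ?lee_fin ?G0// B0.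
move=> h mh h0 hGB.
pose k x := Num.max (h x - G x)%R 0%R.
have mk : measurable_fun D k.
  apply: measurable_maxr => //.
  by apply: measurable_funB => //; exact: measurable_funTS.
have k0 x : (0 <= k x)%R by rewrite /k le_max lexx orbT.
apply: (@le_trans _ _ (\int[mu]_(x in D) ((G x)%:E + (k x)%:E))).
  apply: ge0_le_integral_nm => x Dx.
  - by rewrite lee_fin.
  - by rewrite lee_fin addr_ge0 ?G0.
  - by split => //; rewrite lee_fin -lerBlDl /k le_max lexx.
rewrite ge0_integralD_EFin//.
apply: leeD => //; apply: ge0_le_integral_nm => // x Dx; first by rewrite lee_fin.
split => //; rewrite /k.
have [hG|hG] := leP (h x - G x)%R 0%R; first exact: B0.
by have := hGB x Dx; rewrite -leeBlDl// EFinB.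
Qed.

Lemma ge0_integralZl_le_nm D (c : R) B : measurable D -> (0 < c)%R ->
  (forall x, D x -> 0 <= B x) ->
  \int[mu]_(x in D) (c%:E * B x) <= c%:E * \int[mu]_(x in D) B x.
Proof.
move=> mD c0 B0; apply: ge0_integral_ub_nm => //.
  by move=> x Dx; rewrite mule_ge0 ?B0// lee_fin ltW.
move=> h mh h0 hB.
have -> : \int[mu]_(x in D) (h x)%:E =
    \int[mu]_(x in D) (c * (c^-1 * h x)%R)%:E.
  by apply: eq_integral => x _; rewrite mulrA mulfV ?mul1r// gt_eqF.
rewrite ge0_integralZl_EFinr ?(ltW c0)//; last 2 first.
- by apply: measurable_funM => //; exact: measurable_funTS.
- by move=> x Dx; rewrite mulr_ge0// invr_ge0 ltW.
apply: lee_wpmul2l; first by rewrite lee_fin ltW.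
apply: ge0_le_integral_nm => // x Dx.
  by rewrite lee_fin mulr_ge0// invr_ge0 ltW.
split => //; rewrite EFinM lee_pdivrMl//; exact: hB.
Qed.

End lower_integral.

(** * Integrals over short time intervals and iterated integrals over R^n *)

Section slab_integral.
Context {R : realType}.
Local Notation mu := (@lebesgue_measure R).
Import HBNNSimple.

(* The integrand is not assumed to be measurable: a simple function that almost
   realises the integral over ]0, b[ leaves little room for the part on ]0, e[. *)
Lemma integral_small_interval (b : R) (f : R -> \bar R) : 0 < b ->
  (forall x, 0 < x < b -> (0 <= f x)%E) ->
  (\int[mu]_(x in `]0%R, b[) f x < +oo)%E ->
  forall e, 0 < e -> exists2 a, 0 < a <= b &
    (\int[mu]_(x in `]0%R, a[) f x <= e%:E)%E.
Proof.
move=> b0 f0 fin e e0.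
have f0' x : `]0%R, b[%classic x -> (0 <= f x)%E.
  by rewrite /= in_itv/=; exact: f0.
have fnum : (\int[mu]_(x in `]0%R, b[) f x)%E \is a fin_num.
  by rewrite ge0_fin_numE//; exact: integral_ge0.
have [h hf hI] : exists2 h : {nnsfun measurableTypeR R >-> R},
    (forall x, (h x)%:E <= (f \_ `]0%R, b[) x)%E &
    (\int[mu]_(x in `]0%R, b[) f x - (e / 2)%:E < \int[mu]_x (h x)%:E)%E.
  have e2 : 0 < e / 2 by rewrite divr_gt0.
  have := fnum; rewrite ge0_integralE// => fnum'.
  have [_ [h hf <-] hI] := ub_ereal_sup_adherent e2 fnum'.
  by exists h => //; rewrite integralT_nnsfun.
have [K [K0 hK]] : exists K : R, 0 < K /\ forall x, h x <= K.
  have /finite_seqP[s hs] : finite_set (range h) by exact: fimfunP.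
  exists (1 + \sum_(y <- s) `|y|); split.
    by rewrite ltr_pwDl// sumr_ge0.
  move=> x; have : h x \in s.
    have : range h (h x) by exists x.
    by rewrite hs.
  move=> hxs; rewrite (big_rem (h x))//=.
  have h0 : 0 <= h x by [].
  rewrite (ger0_norm h0).
  have : 0 <= \sum_(y <- rem (h x) s) `|y| by rewrite sumr_ge0.
  lra.
(* As [h] is bounded by [K], it has mass at most e / 2 on ]0, a[. *)
pose a := Num.min b (e / 2 / K).
have a0 : 0 < a by rewrite lt_min b0 divr_gt0// divr_gt0.
have ab : a <= b by rewrite ge_min lexx.
have aK : K * a <= e / 2.
  by rewrite mulrC -ler_pdivlMr// ge_min lexx orbT.
exists a; first by rewrite a0.
apply: ge0_integral_ub_nm => //.
  move=> x /=; rewrite in_itv/= => /andP[x0 xa]; apply: f0.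
  by rewrite x0 (lt_le_trans xa).
move=> g mg g0 gf.
(* A minorant [g] on ]0, a[ glued to [h] on [a, b[ is again a minorant of [f]. The glued integral is
   at most that of [f], which exceeds the integral of [h] by less than e / 2; cancelling the common
   part on [a, b[ leaves at most e for [g]. *)
pose g1 x := g x * \1_(`]0%R, a[%classic) x.
pose h1 x := h x * \1_(`[a, b[%classic) x.
have mg1 : measurable_fun setT g1.
  by apply: measurable_funM => //; exact: measurable_indic.
have mh1 : measurable_fun setT h1.
  by apply: measurable_funM => //; exact: measurable_indic.
have g10 x : 0 <= g1 x by rewrite mulr_ge0.
have h10 x : 0 <= h1 x by rewrite mulr_ge0.
have step1 : (\int[mu]_x ((g1 x)%:E + (h1 x)%:E) <= \int[mu]_(x in `]0%R, b[) f x)%E.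
  rewrite [leRHS]integral_mkcond; apply: ge0_le_integral_nm => x _.
  - by rewrite -EFinD lee_fin addr_ge0.
  - by apply: erestrict_ge0.
  split => //; rewrite -EFinD /g1 /h1 !indicE.
  have := hf x; rewrite /patch.
  have [xa|xa] := boolP (x \in `]0%R, a[%classic).
    have -> : (x \in `[a, b[%classic) = false.
      by apply/memNset => /=; move: xa; rewrite inE/= !in_itv/= leNgt => /andP[_ ->].
    rewrite mulr1 mulr0 addr0 mem_set => [_|]; first by apply: gf; exact: set_mem.
    move: xa; rewrite inE/= !in_itv/= => /andP[-> /=].
    by move/lt_le_trans; apply.
  rewrite mulr0 add0r.
  have [xb|xb] := boolP (x \in `[a, b[%classic).
    by rewrite mulr1.
  by rewrite mulr0 => _; case: ifPn => //; rewrite inE => /f0'.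
have step2 : (\int[mu]_x (h x)%:E <= (K * a)%:E + \int[mu]_x (h1 x)%:E)%E.
  have -> : (K * a)%:E = (\int[mu]_x (K * \1_(`]0%R, a[%classic) x)%:E)%E.
    rewrite ge0_integralZl_EFinr ?(ltW K0)//.
    by rewrite integral_indic// setIT/= lebesgue_measure_itv/= lte_fin a0 -EFinD subr0.
  rewrite -ge0_integralD_EFin//; last 2 first.
  - by apply: measurable_funM => //; exact: measurable_indic.
  - by move=> x _; rewrite mulr_ge0// ltW.
  apply: ge0_le_integral_nm => x _.
  - by rewrite lee_fin.
  - by rewrite -EFinD lee_fin addr_ge0// mulr_ge0// ltW.
  split => //; rewrite -EFinD lee_fin.
  have := hf x; rewrite /h1 /patch !indicE.
  have [xa|xa] := boolP (x \in `]0%R, a[%classic).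
    by rewrite mulr1 => _; apply: (le_trans (hK x)); rewrite lerDl mulr_ge0.
  rewrite mulr0 add0r.
  have [xb|xb] := boolP (x \in `[a, b[%classic); first by rewrite mulr1.
  rewrite memNset ?lee_fin ?mulr0//=.
  move: xa xb; rewrite !notin_setE/= !in_itv/= => /negP xa /negP xb.
  apply/negP; move: xa xb; rewrite !negb_and -!leNgt -!ltNge => /orP[->//|ax] /orP[|->].
    by rewrite ltNge ax.
  by rewrite orbT.
have -> : (\int[mu]_(x in `]0%R, a[) (g x)%:E = \int[mu]_x (g1 x)%:E)%E.
  rewrite integral_mkcond; apply: eq_integral => x _.
  by rewrite /g1 indicE /patch; case: ifP; rewrite ?mulr1 ?mulr0.
rewrite ge0_integralD_EFin// in step1.
have G0 : (0 <= \int[mu]_x (g1 x)%:E)%E by apply: integral_ge0 => x _; rewrite lee_fin.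
have H0 : (0 <= \int[mu]_x (h1 x)%:E)%E by apply: integral_ge0 => x _; rewrite lee_fin.
have HH0 : (0 <= \int[mu]_x (h x)%:E)%E by apply: integral_ge0 => x _; rewrite lee_fin.
move: G0 H0 HH0 hI step1 step2.
case: (integral mu _ f) fnum => // I _.
case: (integral mu _ (fun x => (g1 x)%:E)) => [A||]//;
case: (integral mu _ (fun x => (h1 x)%:E)) => [B||]//;
case: (integral mu _ (fun x => (h x)%:E)) => [C||]//.
rewrite -?EFinB -?EFinD ?lee_fin ?lte_fin; lra.
Qed.

Lemma int_Rn_ge0 n (f : 'rV[R]_n -> \bar R) :
  (forall y, 0 <= f y)%E -> (0 <= int_Rn f)%E.
Proof.
elim: n f => [|n IH] f f0 /=; first exact: f0.
by apply: integral_ge0 => a _; apply: IH => v; exact: f0.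
Qed.

Lemma le_int_Rn n (f g : 'rV[R]_n -> \bar R) :
  (forall y, 0 <= f y)%E -> (forall y, f y <= g y)%E ->
  (int_Rn f <= int_Rn g)%E.
Proof.
elim: n f g => [|n IH] f g f0 fg /=; first exact: fg.
have g0 y : (0 <= g y)%E by exact: le_trans (fg y).
apply: ge0_le_integral_nm => a _; last split => //.
- by apply: int_Rn_ge0 => v; exact: f0.
- by apply: int_Rn_ge0 => v; exact: g0.
- by apply: IH => v; [exact: f0|exact: fg].
Qed.

Lemma int_RnZ_le n (c : R) (f : 'rV[R]_n -> \bar R) : 0 < c ->
  (forall y, 0 <= f y)%E -> (int_Rn (fun y => c%:E * f y) <= c%:E * int_Rn f)%E.
Proof.
move=> c0; elim: n f => [|n IH] f f0 /=; first by [].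
apply: (@le_trans _ _ (\int[mu]_a (c%:E * int_Rn (fun v => f (row_mx a%:M v))))%E).
  apply: ge0_le_integral_nm => a _; last split => //.
  - by apply: int_Rn_ge0 => v; rewrite mule_ge0 ?f0// lee_fin ltW.
  - by rewrite mule_ge0 ?lee_fin ?(ltW c0)//; apply: int_Rn_ge0 => v; exact: f0.
  - by apply: IH => v; exact: f0.
by apply: ge0_integralZl_le_nm => // a _; apply: int_Rn_ge0 => v; exact: f0.
Qed.

Lemma row_mx_scalar0 n (a : R) (v : 'rV[R]_n) :
  (row_mx a%:M v : 'rV[R]_n.+1) ord0 ord0 = a.
Proof.
transitivity ((row_mx a%:M v : 'M[R]_(1, (1 + n)%N)) ord0 (lshift n ord0)).
  by congr (fun_of_matrix _ _ _); exact: val_inj.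
by rewrite row_mxEl mxE eqxx.
Qed.

Lemma row_mx_scalarS n (a : R) (v : 'rV[R]_n) (i : 'I_n) :
  (row_mx a%:M v : 'rV[R]_n.+1) ord0 (lift ord0 i) = v ord0 i.
Proof.
transitivity ((row_mx a%:M v : 'M[R]_(1, (1 + n)%N)) ord0 (rshift 1 i)).
  by congr (fun_of_matrix _ _ _); exact: val_inj.
by rewrite row_mxEr.
Qed.

(** The constant [c] makes the induction work: once the first coordinate is frozen, its factor is
    absorbed into [c]. The product will be a Gaussian, and [B] a remainder about whose measurability
    nothing is known. *)
Lemma int_Rn_prodD_le n (c J : R) (g : 'I_n -> R -> R) (B : 'rV[R]_n -> \bar R) :
  0 <= c -> 0 <= J ->
  (forall i, measurable_fun setT (g i)) -> (forall i a, 0 <= g i a) ->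
  (forall i, \int[mu]_a (g i a)%:E <= J%:E)%E ->
  (forall y, 0 <= B y)%E ->
  (int_Rn (fun y => (c * \prod_(i < n) g i (y ord0 i))%:E + B y)
    <= (c * J ^+ n)%:E + int_Rn B)%E.
Proof.
elim: n c g B => [|n IH] c g B c0 J0 mg g0 gJ B0 /=.
  by rewrite big_ord0 expr0.
pose B' a := int_Rn (fun v => B (row_mx a%:M v)).
apply: (@le_trans _ _ (\int[mu]_a ((c * g ord0 a * J ^+ n)%:E + B' a))%E).
  apply: ge0_le_integral_nm => a _; last split => //.
  - apply: int_Rn_ge0 => v; rewrite adde_ge0// lee_fin mulr_ge0// prodr_ge0//.
  - by rewrite adde_ge0 ?lee_fin ?mulr_ge0 ?exprn_ge0//; apply: int_Rn_ge0 => v.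
  apply: (le_trans _ (IH (c * g ord0 a) (fun i => g (lift ord0 i)) (fun v => B (row_mx a%:M v)) _ _ _ _ _ _)) => //.
  - apply: le_int_Rn => v.
      by rewrite adde_ge0// lee_fin mulr_ge0// prodr_ge0.
    rewrite big_ord_recl row_mx_scalar0 mulrA.
    rewrite (eq_bigr (fun i => g (lift ord0 i) (v ord0 i)))// => i _.
    by rewrite row_mx_scalarS.
  - by rewrite mulr_ge0.
apply: (le_trans (ge0_integralD_le_nm mu setT (fun a => c * g ord0 a * J ^+ n) B' _ _ _ _)) => //.
- apply: measurable_funM; last exact: measurable_cst.
  by apply: measurable_funM; [exact: measurable_cst|exact: mg].
- by move=> a _; rewrite !mulr_ge0 ?exprn_ge0.
- by move=> a _; apply: int_Rn_ge0.
apply: leeD => //.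
have -> : (\int[mu]_x (c * g ord0 x * J ^+ n)%:E = \int[mu]_x (c * J ^+ n * g ord0 x)%:E)%E.
  by apply: eq_integral => x _; rewrite mulrAC.
rewrite ge0_integralZl_EFinr ?mulr_ge0 ?exprn_ge0//; last exact: mg.
rewrite exprSr mulrA [leRHS]EFinM; apply: lee_wpmul2l => //.
by rewrite lee_fin mulr_ge0 ?exprn_ge0.
Qed.

Lemma int_Rn_box_ge n (c l : R) (x : 'rV[R]_n) (f : 'rV[R]_n -> \bar R) :
  0 <= c -> 0 < l -> (forall y, 0 <= f y)%E ->
  (forall y : 'rV[R]_n, (forall i, `|y ord0 i - x ord0 i| <= l) -> (c%:E <= f y)%E) ->
  ((c * (2 * l) ^+ n)%:E <= int_Rn f)%E.
Proof.
elim: n x f => [|n IH] x f c0 l0 f0 fc /=.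
  by rewrite expr0 mulr1; apply: fc => -[].
pose A := `[x ord0 ord0 - l, x ord0 ord0 + l]%classic.
have muA : mu A = (2 * l)%:E.
  rewrite /A lebesgue_measure_itv/= lte_fin ltrBlDr -addrA ltrDl addr_gt0//.
  by rewrite -EFinD; congr (_%:E); ring.
have -> : (c * (2 * l) ^+ n.+1)%:E =
    (\int[mu]_(a in A) (cst (c * (2 * l) ^+ n)%:E) a)%E.
  apply: esym; apply: (eq_trans (integral_cst mu _ _)); first exact: measurable_itv.
  by rewrite [X in (_ * X)%E]muA exprSr mulrA.
apply: ge0_le_integral_nm => a.
- by move=> _; rewrite lee_fin mulr_ge0// exprn_ge0//; lra.
- by move=> _; apply: int_Rn_ge0 => v; exact: f0.
rewrite /A /= in_itv/= => /andP[a1 a2]; split => //.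
apply: (IH (\row_i x ord0 (lift ord0 i))) => // v hv.
apply: fc => i; have [j ->|->] := unliftP ord0 i.
  by rewrite row_mx_scalarS; have := hv j; rewrite mxE.
by rewrite row_mx_scalar0 ler_norml; apply/andP; split; lra.
Qed.

End slab_integral.

(** * The maximum principle and interior estimates *)

Section one_variable.
Context {R : realType}.
Implicit Types f g : R -> R.

Lemma is_derive_gt0_near f (x a : R) : is_derive x 1 f a -> 0 < a ->
  exists2 e, 0 < e & forall h, 0 < h < e -> f x < f (x + h) /\ f (x - h) < f x.
Proof.
move=> /is_derive1_caratheodory[g [fg cg gx]] a0.
have : \forall z \near x, 0 < g z.
  by apply: (@cvgr_gt _ _ (nbhs x) _ g (g x) cg); rewrite gx.
move=> /nbhs_ballP[e e0 He]; exists e => // h /andP[h0 he].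
split.
  rewrite -subr_gt0 fg [x + h]addrC addrK mulr_gt0//; apply: He => /=.
  by rewrite -ball_normE /= opprD addrCA subrr addr0 normrN gtr0_norm.
rewrite -subr_lt0 fg addrAC subrr add0r pmulr_rlt0 ?oppr_lt0//; apply: He => /=.
by rewrite -ball_normE /= opprB addrC subrK gtr0_norm.
Qed.

Lemma is_derive_left_max_ge0 f (t a e : R) : 0 < e -> is_derive t 1 f a ->
  (forall s, t - e < s < t -> f s <= f t) -> 0 <= a.
Proof.
move=> e0 df fmax; rewrite leNgt; apply/negP => a0.
have [|e1 e10 He1] := @is_derive_gt0_near (- f) t (- a) _ _.
  by rewrite oppr_gt0.
pose h := Num.min e e1 / 2.
have m0 : 0 < Num.min e e1 by rewrite lt_min e0.
have me : Num.min e e1 <= e by rewrite ge_min lexx.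
have me1 : Num.min e e1 <= e1 by rewrite ge_min lexx orbT.
have [|_] := He1 h; first by rewrite /h; apply/andP; split; lra.
rewrite /= !fctE ltrN2 ltNge => /negP; apply; apply: fmax.
by rewrite /h; apply/andP; split; lra.
Qed.

(** The second derivative of [g] at 0 is [b], with [g] differentiable near 0. As a relation it
    passes directly to combinations of a solution, its reflection and a barrier. *)
Definition second_derive g (b : R) := exists (e : R) (g' : R -> R),
  [/\ 0 < e, forall s : R, `|s| < e -> is_derive s 1 g (g' s) & is_derive (0 : R) 1 g' b].

(** At the maximum g'(0) = 0, so b > 0 would make g' positive just to the right of 0, and the mean
    value theorem would give g(h) > g(0). *)
Lemma second_derive_max_le0 g (b e : R) : 0 < e -> second_derive g b ->
  (forall s, `|s| < e -> g s <= g 0) -> b <= 0.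
Proof.
move=> e0 [e1 [g' [e10 dg dg']]] gmax; rewrite leNgt; apply/negP => b0.
pose m := Num.min e e1.
have m0 : 0 < m by rewrite lt_min e0.
have me : m <= e by rewrite ge_min lexx.
have me1 : m <= e1 by rewrite ge_min lexx orbT.
have in_m s : s \in `]- m, m[%R -> `|s| < m by rewrite in_itv/= ltr_norml.
have g'0 : g' 0 = 0.
  have d0 : is_derive (0 : R) 1 g 0.
    apply: (@derive1_at_max _ g (- m) m 0).
    - by lra.
    - by move=> s /in_m sm; have /= [] := dg s (lt_le_trans sm me1).
    - by rewrite in_itv/= m0 oppr_lt0 m0.
    - by move=> s /in_m sm; apply: gmax; exact: lt_le_trans me.
  have d1 : is_derive (0 : R) 1 g (g' 0) by apply: dg; rewrite normr0.
  by rewrite -(@derive_val _ _ _ _ _ _ _ d1) (@derive_val _ _ _ _ _ _ _ d0).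
have [e2 e20 He2] := is_derive_gt0_near _ _ _ dg' b0.
pose h := Num.min m e2 / 2.
have n0 : 0 < Num.min m e2 by rewrite lt_min m0.
have nm : Num.min m e2 <= m by rewrite ge_min lexx.
have ne2 : Num.min m e2 <= e2 by rewrite ge_min lexx orbT.
have h0 : 0 < h by rewrite /h; lra.
have hm : h < m by rewrite /h; lra.
have dg0h (s : R) : 0 <= s <= h -> is_derive s 1 g (g' s).
  by move=> /andP[s0 sh]; apply: dg; rewrite ger0_norm//; lra.
have [||c c0h] := @MVT _ g g' 0 h h0.
- move=> s; rewrite in_itv/= => /andP[s0 sh].
  by apply: dg0h; rewrite (ltW s0) (ltW sh).
- apply: derivable_within_continuous => s; rewrite in_itv/= => s0h.
  by have [] := dg0h s s0h.
rewrite subr0 => E.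
have : g h <= g 0 by apply: gmax; rewrite gtr0_norm//; lra.
rewrite -subr_le0 E leNgt => /negP; apply; rewrite mulr_gt0//.
move: c0h; rewrite in_itv/= => /andP[c0 ch].
have [|+ _] := He2 c; first by rewrite /h in ch; apply/andP; split; lra.
by rewrite g'0 add0r.
Qed.

Lemma second_deriveD f g a b : second_derive f a -> second_derive g b ->
  second_derive (fun s => f s + g s) (a + b).
Proof.
move=> [e1 [f' [e10 df df']]] [e2 [g' [e20 dg dg']]].
exists (Num.min e1 e2), (fun s => f' s + g' s); split.
- by rewrite lt_min e10.
- by move=> s; rewrite lt_min => /andP[s1 s2]; apply: is_deriveD; [exact: df|exact: dg].
- exact: is_deriveD.
Qed.

Lemma second_deriveZ f a c : second_derive f a ->
  second_derive (fun s => c * f s) (c * a).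
Proof.
move=> [e1 [f' [e10 df df']]]; exists e1, (fun s => c * f' s); split => //.
- by move=> s /df dfs; exact: (@is_deriveZ _ _ _ f c s 1 (f' s)).
- exact: (@is_deriveZ _ _ _ f' c 0 1 a).
Qed.

Lemma second_derive_quad (c0 c1 c2 : R) :
  second_derive (fun s => c0 + c1 * s + c2 * s ^+ 2) (2 * c2).
Proof.
exists 1, (fun s => c1 + 2 * c2 * s); split => // [s _|].
  apply: is_derive_eq.
  rewrite /GRing.scale/=; ring.
apply: is_derive_eq.
rewrite /GRing.scale/=; ring.
Qed.

End one_variable.

Section directional.
Context {R : realType} {n : nat}.
Implicit Types (u : 'rV[R]_n -> R -> R) (x y : 'rV[R]_n) (t : R).

Lemma is_derive_line (f : 'rV[R]_n -> R) x v (s : R) :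
  derivable f (x + s *: v) v ->
  is_derive s 1 (fun r => f (x + r *: v)) ('D_v f (x + s *: v)).
Proof.
have E : (fun h : R => h^-1 *: (((fun r => f (x + r *: v)) \o shift s) (h *: 1) - f (x + s *: v)))
   = (fun h : R => h^-1 *: ((f \o shift (x + s *: v)) (h *: v) - f (x + s *: v))).
  apply/funext => h /=; congr (_ *: (f _ - _)).
  by rewrite [_ *: 1]mulr1 scalerDl addrCA.
move=> df; apply: DeriveDef; first by rewrite /derivable E.
by rewrite /derive E.
Qed.

(** The factor [c] allows c = -1, for a coordinate line that a reflection runs backwards. *)
Lemma second_derive_line u x t (i : 'I_n) (c : R) : C21_slab u -> 0 < t < 16 ->
  second_derive (fun s => u (x + (c * s) *: evec i) t)
    (c ^+ 2 * dx (dx u i) i x t).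
Proof.
move=> Cu ht.
exists 1, (fun s => dx u i (x + (c * s) *: evec i) t * c); split => //.
- move=> s _.
  have [_ _ /(_ i)[d1 _] _] := Cu (x + (c * s) *: evec i) t ht.
  have := @is_derive_line (fun y => u y t) x (evec i) (c * s) d1.
  move=> D; have := @is_derive1_comp _ _ (fun s => c * s) s _ c D _.
  apply; apply: is_derive_eq; rewrite /GRing.scale/=; ring.
- have [_ _ _ /(_ i i)[d2 _]] := Cu x t ht.
  have d2' : derivable (fun y => dx u i y t) (x + (c * 0) *: evec i) (evec i).
    by rewrite mulr0 scale0r addr0.
  have := @is_derive_line (fun y => dx u i y t) x (evec i) (c * 0) d2'.
  rewrite [in 'D__ _ _]mulr0 scale0r addr0 => D.
  have D' := @is_derive1_comp _ _ (fun s => c * s) 0 _ c D _.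
  have /D' {}D' : is_derive (0 : R) 1 (fun s => c * s) c.
    by apply: is_derive_eq; rewrite /GRing.scale/=; ring.
  apply: is_derive_eq.
  by rewrite scaler0 add0r /dx /GRing.scale/= expr2 -mulrA [X in c * X]mulrC.
Qed.

End directional.

(** * Parabolic maximum principle on boxes, and quadratic barriers *)

Section maximum_principle.
Context {R : realType} {n : nat}.
Implicit Types (u v w : 'rV[R]_n -> R -> R) (x y p lo hi : 'rV[R]_n) (t : R).

Lemma evecE (i j : 'I_n) (s : R) : (s *: evec i) ord0 j = s * (j == i)%:R.
Proof. by rewrite !mxE eqxx/=. Qed.

Lemma parabolic_maximum_principle v lo hi (ta tb : R) :
  (forall i, lo ord0 i <= hi ord0 i) -> ta <= tb ->
  (forall y t, (forall i, lo ord0 i <= y ord0 i <= hi ord0 i) ->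
    ta <= t <= tb -> jcont v y t) ->
  (forall y t, (forall i, lo ord0 i <= y ord0 i <= hi ord0 i) ->
    ta <= t <= tb ->
    (exists i, y ord0 i = lo ord0 i \/ y ord0 i = hi ord0 i) \/ t = ta ->
    v y t <= 0) ->
  (forall y t, (forall i, lo ord0 i < y ord0 i < hi ord0 i) -> ta < t <= tb ->
    exists a (b : 'I_n -> R), [/\ is_derive t 1 (v y) a,
      forall i, second_derive (fun s => v (y + s *: evec i) t) (b i) &
      a < \sum_i b i]) ->
  forall y t, (forall i, lo ord0 i <= y ord0 i <= hi ord0 i) ->
    ta <= t <= tb -> v y t <= 0.
Proof.
move=> lohi tab cv bv iv.
pose A : set 'rV[R]_n := [set y | forall i, `[lo ord0 i, hi ord0 i]%classic (y ord0 i)].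
pose D : set ('rV[R]_n * R) := A `*` `[ta, tb].
have DP q : D q -> (forall i, lo ord0 i <= q.1 ord0 i <= hi ord0 i) /\ ta <= q.2 <= tb.
  move=> [q1 q2]; split; last by move: q2; rewrite /= in_itv.
  by move=> i; have := q1 i; rewrite /= in_itv.
have DQ y t : (forall i, lo ord0 i <= y ord0 i <= hi ord0 i) -> ta <= t <= tb -> D (y, t).
  move=> hy ht; split; last by rewrite /= in_itv.
  by move=> i; rewrite /= in_itv/=.
have cA : compact A.
  apply: (@rV_compact _ _ (fun i => `[lo ord0 i, hi ord0 i]%classic)) => i.
  exact: segment_compact.
have cD : compact D.
  by apply: compact_setX => //; exact: segment_compact.
have D0 : D !=set0.
  exists (lo, ta); apply: DQ => [i|]; first by rewrite lexx lohi.
  by rewrite lexx tab.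
have cvD : {within D, continuous (fun q : 'rV[R]_n * R => v q.1 q.2)}.
  apply: continuous_in_subspaceT => q; rewrite inE => /DP[q1 q2].
  by have := cv _ _ q1 q2; rewrite /jcont; case: q q1 q2.
have [[y0 t0] + vmax] := compact_EVT_max D0 cD cvD.
rewrite inE => /DP /= [hy0 ht0].
suff v0 : v y0 t0 <= 0.
  by move=> y t hy ht; apply: le_trans v0; apply: (vmax (y, t)); rewrite inE; exact: DQ.
have [[i yi]|/forallNP yint] := pselect (exists i, y0 ord0 i = lo ord0 i \/ y0 ord0 i = hi ord0 i).
  by apply: bv => //; left; exists i.
have [tE|tN] := eqVneq t0 ta; first by apply: bv => //; right.
have hy0' i : lo ord0 i < y0 ord0 i < hi ord0 i.
  have /not_orP[/eqP n1 /eqP n2] := yint i.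
  have /andP[h1 h2] := hy0 i.
  by rewrite !lt_neqAle h1 h2 n2 eq_sym n1.
have /andP[ta0 t0b] := ht0.
have ht0' : ta < t0 <= tb by rewrite lt_neqAle eq_sym tN ta0.
exfalso.
have [a [b [da db]]] := iv _ _ hy0' ht0'.
apply/negP; rewrite -leNgt.
apply: (@le_trans _ _ 0); last first.
  apply: (@is_derive_left_max_ge0 _ (v y0) t0 a (t0 - ta)) => //.
    by rewrite subr_gt0; case/andP: ht0'.
  move=> s; rewrite opprB addrC subrK => /andP[s1 s2].
  apply: (vmax (y0, s)); rewrite inE; apply: DQ => //.
  by rewrite (ltW s1) (le_trans (ltW s2)).
apply: sumr_le0 => i _.
pose e := Num.min (y0 ord0 i - lo ord0 i) (hi ord0 i - y0 ord0 i).
have /andP[l1 l2] := hy0' i.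
apply: (@second_derive_max_le0 _ (fun s => v (y0 + s *: evec i) t0) _ e) => //.
  by rewrite lt_min !subr_gt0 l1 l2.
move=> s; rewrite lt_min => /andP[s1 s2].
rewrite [in leRHS]scale0r addr0; apply: (vmax (_, t0)); rewrite inE; apply: DQ => // j.
rewrite mxE evecE; have [->|_] := eqVneq j i; last by rewrite mulr0 addr0.
rewrite mulr1; move: s1 s2; rewrite !ltr_norml => /andP[? ?] /andP[? ?].
by apply/andP; split; lra.
Qed.

(** One family for both comparisons: [b] and [d] single out a coordinate for the reflection
    argument, while b = d = 0 gives the radial barrier of the lower bound in time. *)
Definition quad_barrier p (i : 'I_n) (A b d T c : R) : 'rV[R]_n -> R -> R :=
  fun y t => A * \sum_j (y ord0 j - p ord0 j) ^+ 2
    + (b * (y ord0 i - p ord0 i) + d * (y ord0 i - p ord0 i) ^+ 2) + (T * t + c).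

Lemma quad_barrier_jcont p i A b d T c y t : jcont (quad_barrier p i A b d T c) y t.
Proof.
have cc j : {for (y, t), continuous (fun q : 'rV[R]_n * R => q.1 ord0 j - p ord0 j)}.
  apply: cvgB; last exact: cvg_cst.
  apply: (@continuous_comp _ _ _ fst (fun z : 'rV[R]_n => z ord0 j)).
    exact: cvg_fst.
  exact: coord_continuous.
have cX (f : 'rV[R]_n * R -> R) : {for (y, t), continuous f} ->
    {for (y, t), continuous (fun q => f q ^+ 2)}.
  by move=> cf; apply: (@continuous_comp _ _ _ f (fun z : R => z ^+ 2)) => //; exact: exprn_continuous.
have cZ (k : R) (f : 'rV[R]_n * R -> R) : {for (y, t), continuous f} ->
    {for (y, t), continuous (fun q => k * f q)}.
  by move=> cf; apply: cvgM => //; exact: cvg_cst.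
rewrite /jcont /quad_barrier.
apply: cvgD; last first.
  apply: cvgD; last exact: cvg_cst.
  by apply: cZ; exact: cvg_snd.
apply: cvgD.
  apply: cZ.
  apply: cvg_big => [|j _]; last exact: cX.
  exact: add_continuous.
by apply: cvgD; apply: cZ => //; apply: cX.
Qed.

Lemma quad_barrier_dt p i A b d T c y t :
  is_derive t 1 (quad_barrier p i A b d T c y) T.
Proof.
rewrite /quad_barrier; apply: is_derive_eq.
by rewrite /GRing.scale/=; ring.
Qed.

Lemma quad_barrier_d2 p i A b d T c y t (j : 'I_n) :
  second_derive (fun s => quad_barrier p i A b d T c (y + s *: evec j) t)
    (2 * (A + d * (j == i)%:R)).
Proof.
have -> : (fun s => quad_barrier p i A b d T c (y + s *: evec j) t) =
  (fun s => quad_barrier p i A b d T c y t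
    + (2 * A * (y ord0 j - p ord0 j) + (b + 2 * d * (y ord0 i - p ord0 i)) * (j == i)%:R) * s
    + (A + d * (j == i)%:R) * s ^+ 2).
  apply/funext => s; rewrite /quad_barrier.
  rewrite (bigD1 j)//= [in RHS](bigD1 j)//=.
  rewrite (eq_bigr (fun k => (y ord0 k - p ord0 k) ^+ 2)); last first.
    by move=> k /negbTE kj; rewrite mxE evecE kj mulr0 addr0.
  rewrite !mxE eqxx/= mulr1 [i == j]eq_sym.
  by case: (eqVneq j i) => [->|_] /=; ring.
exact: second_derive_quad.
Qed.

End maximum_principle.

(** * Spatial Lipschitz estimate by reflection *)

Section interior_estimates.
Context {R : realType} {n : nat}.
Implicit Types (u : 'rV[R]_n -> R -> R) (x y p : 'rV[R]_n) (t : R).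

(** The cross section is a cube because [int_Rn] is iterated over coordinates and the maximum
    principle is run on boxes with faces orthogonal to the axes. *)
Definition in_cyl x (t0 r : R) y t :=
  (forall i, `|y ord0 i - x ord0 i| <= r) /\ t0 - r ^+ 2 <= t <= t0.

Let refl p (i : 'I_n) y := y + (2 * (p ord0 i - y ord0 i)) *: evec i.

Let reflE p i y j :
  refl p i y ord0 j = if j == i then 2 * p ord0 i - y ord0 i else y ord0 j.
Proof.
by rewrite mxE evecE; case: (eqVneq j i) => [->|_] /=; ring.
Qed.

Let jcont_refl u p i y t : jcont u (refl p i y) t ->
  jcont (fun y t => u (refl p i y) t) y t.
Proof.
move=> cu; rewrite /jcont.
have cc : {for (y, t), continuous (fun q : 'rV[R]_n * R => q.1 ord0 i)}.
  apply: (@continuous_comp _ _ _ fst (fun z : 'rV[R]_n => z ord0 i)).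
    exact: cvg_fst.
  exact: coord_continuous.
have c1 : (fun q : 'rV[R]_n * R => refl p i q.1) @ (y, t) --> refl p i y.
  apply: cvgD; first exact: cvg_fst.
  apply: cvgZ; last exact: cvg_cst.
  apply: cvgM; first exact: cvg_cst.
  by apply: cvgB; [exact: cvg_cst|exact: cc].
have c2 : (fun q : 'rV[R]_n * R => q.2) @ (y, t) --> t by exact: cvg_snd.
exact: (@continuous_comp _ _ _ (fun q : 'rV[R]_n * R => (refl p i q.1, q.2))
  (fun q => u q.1 q.2) (y, t) (cvg_pair c1 c2)).
Qed.

Lemma sum_sqr_ge p y (j : 'I_n) :
  (y ord0 j - p ord0 j) ^+ 2 <= \sum_k (y ord0 k - p ord0 k) ^+ 2.
Proof.
by rewrite (bigD1 j)//= lerDl sumr_ge0// => k _; exact: sqr_ge0.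
Qed.

Lemma sum_sqr_ge2 p y (i j : 'I_n) : j != i ->
  (y ord0 i - p ord0 i) ^+ 2 + (y ord0 j - p ord0 j) ^+ 2 <=
  \sum_k (y ord0 k - p ord0 k) ^+ 2.
Proof.
move=> ji; rewrite (bigD1 i)//= lerD2l (bigD1 j)//= lerDl.
by apply: sumr_ge0 => k _; exact: sqr_ge0.
Qed.

Let sum_reflection_defect (i : 'I_n) (c q : R) (F G : 'I_n -> R) (b : R) :
  \sum_j ((c * F j + - c * G j) + (- 1) * (2 * (q + b * (j == i)%:R))) =
  c * \sum_j F j + - c * \sum_j G j + (- 1) * (2 * (q * n%:R + b)).
Proof.
have delta1 : \sum_(j < n) (j == i)%:R = 1 :> R.
  by rewrite (bigD1 i)//= eqxx big1 ?addr0// => j /negbTE->.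
rewrite !big_split/= -!mulr_sumr big_split/= -mulr_sumr delta1 mulr1.
by rewrite sumr_const card_ord mulr_natr.
Qed.

(* [u] is compared with its own reflection in the hyperplane [y_i = p_i]: the
   difference vanishes there, so a barrier that grows linearly away from the
   hyperplane bounds it. *)
Let reflection_estimate u p (i : 'I_n) (t1 rho K c z : R) :
  C21_slab u -> 0 < rho -> 0 < K -> c = 1 \/ c = -1 ->
  0 < t1 - rho ^+ 2 -> t1 < 16 ->
  (forall y t, in_cyl p t1 rho y t -> 0 <= u y t <= K /\
    0 <= dt u y t - laplacian u y t <= K / rho ^+ 2) ->
  0 <= z <= rho ->
  c * (u (p + z *: evec i) t1 - u (p - z *: evec i) t1)
    <= 2 * (n%:R + 1) * K * z / rho.
Proof.
move=> Cu rho0 K0 c1 t10 t116 hyp /andP[z0 zr].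
have rho20 : 0 < rho ^+ 2 by rewrite exprn_gt0.
have [q qE] : exists q, q = K / rho ^+ 2 by exists (K / rho ^+ 2).
have q0 : 0 < q by rewrite qE divr_gt0.
have qK : q * rho ^+ 2 = K by rewrite qE divfK// gt_eqF.
pose B : R := n%:R + 1.
have B1 : 1 <= B by rewrite lerDr.
(* With Z = y_i - p_i and S = |y - p|^2 this is q (S - Z^2 + (t1 - t) + B Z (2 rho - Z)). On the
   half cylinder 0 <= Z <= rho it is >= 0 at Z = 0 and at least q rho^2 = K on the other faces and
   at the initial time. As B = n + 1, w_t - Laplacian w = 3 q, whereas the two sources, both in
   [0, q], differ by at most q. *)
pose w := quad_barrier p i q (2 * B * rho * q) (- (B + 1) * q) (- q) (q * t1).
pose v y t := (c * u y t + (- c) * u (refl p i y) t) + (- 1) * w y t.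
pose lo : 'rV[R]_n := \row_j (if j == i then p ord0 i else p ord0 j - rho).
pose hi : 'rV[R]_n := \row_j (p ord0 j + rho).
have cyl1 y t : (forall j, lo ord0 j <= y ord0 j <= hi ord0 j) ->
    t1 - rho ^+ 2 <= t <= t1 -> in_cyl p t1 rho y t.
  move=> hy ht; split => // j; have := hy j; rewrite !mxE ler_norml.
  by case: (eqVneq j i) => [->|_] /andP[? ?]; apply/andP; split; lra.
have cyl2 y t : in_cyl p t1 rho y t -> in_cyl p t1 rho (refl p i y) t.
  move=> [hy ht]; split => // j; rewrite reflE; have := hy j.
  case: (eqVneq j i) => [->|_] //; rewrite !ler_norml => /andP[? ?].
  by apply/andP; split; lra.
have slab t : t1 - rho ^+ 2 <= t <= t1 -> 0 < t < 16.
  by move=> /andP[? ?]; apply/andP; split; lra.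
have vb y t : in_cyl p t1 rho y t -> c * u y t + (- c) * u (refl p i y) t <= K.
  move=> hy; have [/andP[? ?] _] := hyp _ _ hy.
  have [/andP[? ?] _] := hyp _ _ (cyl2 _ _ hy).
  by case: c1 => ->; lra.
have loi y : (forall j, lo ord0 j <= y ord0 j <= hi ord0 j) ->
    0 <= y ord0 i - p ord0 i <= rho.
  by move=> /(_ i); rewrite !mxE eqxx => /andP[? ?]; apply/andP; split; lra.
have v0 : forall y t, (forall j, lo ord0 j <= y ord0 j <= hi ord0 j) ->
    t1 - rho ^+ 2 <= t <= t1 -> v y t <= 0.
  apply: parabolic_maximum_principle.
  - by move=> j; rewrite !mxE; case: ifP => [/eqP->|_]; lra.
  - by lra.
  - move=> y t hy ht; rewrite /v /jcont.
    have cu z' : jcont u z' t by have [] := Cu z' t (slab _ ht).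
    have cZ (k : R) (f : 'rV[R]_n -> R -> R) : jcont f y t ->
        {for (y, t), continuous (fun q => k * f q.1 q.2)}.
      by move=> cf; apply: cvgM => //; exact: cvg_cst.
    apply: cvgD; last by apply: cZ; exact: quad_barrier_jcont.
    apply: cvgD; first exact: cZ.
    by apply: (cZ _ (fun y t => u (refl p i y) t)); exact: jcont_refl.
  - move=> y t hy ht hb.
    suff : c * u y t + - c * u (refl p i y) t <= w y t by rewrite /v; lra.
    have hc := cyl1 _ _ hy ht.
    have /andP[Z0 Zr] := loi _ hy; set Z := y ord0 i - p ord0 i in Z0 Zr.
    have /andP[ht1 ht2] := ht.
    have wE : w y t = q * (\sum_k (y ord0 k - p ord0 k) ^+ 2 - Z ^+ 2
        + (t1 - t) + B * (Z * (2 * rho - Z))).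
      by rewrite /w /quad_barrier -/Z; ring.
    have Si := sum_sqr_ge p y i; rewrite -/Z in Si.
    set S := \sum_k _ in wE Si.
    have BZ : 0 <= B * (Z * (2 * rho - Z)).
      by rewrite mulr_ge0//; [lra|rewrite mulr_ge0//; lra].
    have [wK|] : (rho ^+ 2 <= S - Z ^+ 2 + (t1 - t) + B * (Z * (2 * rho - Z))) \/ Z = 0.
      case: hb => [[j]|tE]; last by left; rewrite tE; lra.
      rewrite !mxE; case: (eqVneq j i) => [->|ji].
        case=> yE; first by right; rewrite /Z yE subrr.
        left; have ZE : Z = rho by rewrite /Z yE; ring.
        have -> : Z * (2 * rho - Z) = rho ^+ 2 by rewrite ZE; ring.
        have : rho ^+ 2 <= B * rho ^+ 2 by rewrite ler_pMl.
        by lra.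
      move=> yE; left; have := sum_sqr_ge2 p y i j ji; rewrite -/Z -/S.
      have -> : (y ord0 j - p ord0 j) ^+ 2 = rho ^+ 2 by case: yE => ->; ring.
      by lra.
    - apply: (le_trans (vb _ _ hc)).
      by rewrite wE -qK ler_pM2l.
    move=> ZE; have -> : refl p i y = y.
      rewrite /refl (_ : p ord0 i - y ord0 i = 0) ?mulr0 ?scale0r ?addr0//.
      by move: ZE; rewrite /Z; lra.
    rewrite mulNr subrr wE; apply: mulr_ge0; first exact: ltW.
    by lra.
  - move=> y t hy ht.
    have hy' j : lo ord0 j <= y ord0 j <= hi ord0 j.
      by have /andP[? ?] := hy j; rewrite !ltW.
    have ht' : t1 - rho ^+ 2 <= t <= t1 by case/andP: ht => /ltW-> ->.
    have hs := slab _ ht'.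
    have [_ h1] := hyp _ _ (cyl1 _ _ hy' ht').
    have [_ h2] := hyp _ _ (cyl2 _ _ (cyl1 _ _ hy' ht')).
    exists ((c * dt u y t + (- c) * dt u (refl p i y) t) + (- 1) * (- q)).
    exists (fun j => (c * dx (dx u j) j y t + (- c) * dx (dx u j) j (refl p i y) t)
       + (- 1) * (2 * (q + (- (B + 1) * q) * (j == i)%:R))); split.
    + have [_ [d1 _] _ _] := Cu y t hs.
      have [_ [d2 _] _ _] := Cu (refl p i y) t hs.
      have D1 : is_derive t 1 (u y) (dt u y t) by exact: derivableP.
      have D2 : is_derive t 1 (u (refl p i y)) (dt u (refl p i y) t) by exact: derivableP.
      have D3 := quad_barrier_dt p i q (2 * B * rho * q) (- (B + 1) * q) (- q) (q * t1) y t.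
      rewrite -/w in D3.
      exact: is_deriveD.
    + move=> j; apply: second_deriveD; last first.
        by apply: second_deriveZ; exact: quad_barrier_d2.
      apply: second_deriveD; apply: second_deriveZ.
        have := second_derive_line u y t j 1 Cu hs.
        by rewrite expr1n mul1r; under eq_fun do rewrite mul1r.
      (* Along axis [i] the reflected line runs backwards; only e^2 = 1 enters the second
         derivative. *)
      pose e : R := if j == i then -1 else 1.
      have e2 : e ^+ 2 = 1 by rewrite /e; case: ifP => _; rewrite ?sqrrN expr1n.
      have := second_derive_line u (refl p i y) t j e Cu hs.
      rewrite e2 mul1r.
      have -> : (fun s => u (refl p i y + (e * s) *: evec j) t) =
                (fun s => u (refl p i (y + s *: evec j)) t).
        apply/funext => s; congr (u _ t); apply/rowP => k.
        rewrite reflE mxE reflE !mxE eqxx/= /e.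
        case: (eqVneq k i) => ki; case: (eqVneq j i) => ji.
        - by rewrite ki ji eqxx/=; ring.
        - by rewrite ki [i == j]eq_sym (negbTE ji)/=; ring.
        - by rewrite ji (negbTE ki)/=; ring.
        - by ring.
      by [].
    + rewrite (sum_reflection_defect i _ _ (fun j => dx (dx u j) j y t)
        (fun j => dx (dx u j) j (refl p i y) t)).
      rewrite -/(laplacian u y t) -/(laplacian u (refl p i y) t).
      have -> : q * n%:R + - (B + 1) * q = - (2 * q) by rewrite /B; ring.
      move: h1 h2; rewrite -qE.
      move: (dt u y t) (dt u (refl p i y) t) => a b.
      move: (laplacian u y t) (laplacian u (refl p i y) t) => a' b'.
      clear - q0 c1 => /andP[? ?] /andP[? ?].
      by case: c1 => ->; lra.
have reflp : refl p i (p + z *: evec i) = p - z *: evec i.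
  apply/rowP => k; rewrite reflE !mxE eqxx/=.
  by case: (eqVneq k i) => [->|ki] /=; rewrite ?eqxx/=; ring.
have H : c * u (p + z *: evec i) t1 + - c * u (p - z *: evec i) t1 <= w (p + z *: evec i) t1.
  rewrite -reflp.
  suff : v (p + z *: evec i) t1 <= 0 by rewrite /v; lra.
  apply: v0; last by apply/andP; split; lra.
  move=> j; rewrite !mxE eqxx/=.
  by case: (eqVneq j i) => [->|_] /=; apply/andP; split; lra.
have wE : w (p + z *: evec i) t1 = q * (z * (2 * B * rho - B * z)).
  rewrite /w /quad_barrier (bigD1 i)//= big1 ?addr0; last first.
    by move=> j /negbTE ji; rewrite mxE evecE ji mulr0 addr0 subrr expr0n.
  rewrite !mxE !eqxx/=; ring.
have Bz : 0 <= B * z by rewrite mulr_ge0//; lra.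
rewrite mulrBr -mulNr; apply: (le_trans H); rewrite wE.
have -> : 2 * (n%:R + 1) * K * z / rho = q * (z * (2 * B * rho)).
  by rewrite qE /B; field; rewrite gt_eqF.
by rewrite ler_pM2l// ler_wpM2l//; lra.
Qed.

(** Centring at the midpoint makes the reflection exchange the two points; the two signs of [c] in
    the one-sided estimate give the absolute value. *)
Lemma spatial_lipschitz u p (i : 'I_n) (t1 rho K z : R) :
  C21_slab u -> 0 < rho -> 0 < K ->
  0 < t1 - rho ^+ 2 -> t1 < 16 ->
  (forall y t, in_cyl p t1 rho y t -> 0 <= u y t <= K /\
    0 <= dt u y t - laplacian u y t <= K / rho ^+ 2) ->
  `|z| <= rho ->
  `|u (p + z *: evec i) t1 - u (p - z *: evec i) t1|
    <= 2 * (n%:R + 1) * K * `|z| / rho.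
Proof.
move=> Cu rho0 K0 t10 t116 hyp.
have est := reflection_estimate u p i t1 rho K _ _ Cu rho0 K0 _ t10 t116 hyp.
wlog z0 : z / 0 <= z => [hw|].
  have [/hw//|z0] := leP 0 z; rewrite -normrN => zr.
  have /hw := zr; rewrite oppr_ge0 (ltW z0) => /(_ isT).
  by rewrite !scaleNr opprK distrC normrN.
rewrite (ger0_norm z0) => zr.
have h1 := est 1 z (or_introl erefl) _.
have h2 := est (-1) z (or_intror erefl) _.
rewrite ler_norml; apply/andP; split.
  by have := h2 _; rewrite z0 zr => /(_ isT); lra.
by have := h1 _; rewrite z0 zr => /(_ isT); lra.
Qed.

End interior_estimates.

(** * Lower bound on a backward cylinder *)

Section interior_lower_bound.
Context {R : realType} {n : nat}.
Implicit Types (u : 'rV[R]_n -> R -> R) (x y p : 'rV[R]_n) (t : R).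

(** Coordinates are changed one at a time, so that consecutive points are mirror images about their
    midpoint. The midpoints stay within rho of [x0], which is why the hypotheses are imposed on the
    cube of half side 2 rho. *)
Lemma spatial_modulus u x0 (t1 rho K h : R) : C21_slab u ->
  0 < rho -> 0 < K -> 0 < t1 - rho ^+ 2 -> t1 < 16 ->
  (forall y t, (forall i, `|y ord0 i - x0 ord0 i| <= 2 * rho) ->
    t1 - rho ^+ 2 <= t <= t1 -> 0 <= u y t <= K /\
    0 <= dt u y t - laplacian u y t <= K / rho ^+ 2) ->
  0 <= h <= rho ->
  forall x, (forall i, `|x ord0 i - x0 ord0 i| <= h) ->
  `|u x t1 - u x0 t1| <= n%:R * ((n%:R + 1) * K * h / rho).
Proof.
move=> Cu rho0 K0 t10 t116 hyp /andP[h0 hr] x hx.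
pose pt m : 'rV[R]_n := \row_j (if (j < m)%N then x ord0 j else x0 ord0 j).
have ptn : pt n = x by apply/rowP => j; rewrite mxE ltn_ord.
have pt0 : pt 0%N = x0 by apply/rowP => j; rewrite mxE.
suff H m : (m <= n)%N -> `|u (pt m) t1 - u x0 t1| <= m%:R * ((n%:R + 1) * K * h / rho).
  by have := H n (leqnn n); rewrite ptn.
elim: m => [|m IH] mn; first by rewrite pt0 subrr normr0 mul0r.
pose i := Ordinal mn.
pose z := (x ord0 i - x0 ord0 i) / 2.
pose p : 'rV[R]_n := \row_j (if (j < m)%N then x ord0 j else
  if j == i then (x ord0 i + x0 ord0 i) / 2 else x0 ord0 j).
have pz1 : p + z *: evec i = pt m.+1.
  apply/rowP => j; rewrite !mxE eqxx/= [(j < m.+1)%N]ltnS [(j <= m)%N]leq_eqVlt.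
  have [->|ji] := eqVneq j i; first by rewrite /= ltnn eqxx/= /z; lra.
  have -> : (j == m :> nat) = false by apply/negbTE; rewrite -val_eqE in ji.
  by rewrite /= mulr0 addr0.
have pz2 : p - z *: evec i = pt m.
  apply/rowP => j; rewrite !mxE eqxx/=.
  have [->|ji] := eqVneq j i; first by rewrite /= ltnn /z; lra.
  by rewrite mulr0 subr0.
have zh : `|z| <= h / 2.
  by rewrite normrM [ `|2^-1| ]gtr0_norm// ler_pM2r.
have px0 j : `|p ord0 j - x0 ord0 j| <= rho.
  rewrite mxE; case: ifP => _; first exact: le_trans (hx j) hr.
  case: (eqVneq j i) => [->|_]; last by rewrite subrr normr0 ltW.
  have -> : (x ord0 i + x0 ord0 i) / 2 - x0 ord0 i = z by rewrite /z; field.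
  by apply: (le_trans zh); lra.
have := spatial_lipschitz u p i t1 rho K z Cu rho0 K0 t10 t116 _ _.
rewrite pz1 pz2 => L.
have {}L : `|u (pt m.+1) t1 - u (pt m) t1| <= (n%:R + 1) * K * h / rho.
  apply: (le_trans (L _ _)).
  - move=> y t [hy ht]; apply: hyp => // j.
    have -> : y ord0 j - x0 ord0 j = (y ord0 j - p ord0 j) + (p ord0 j - x0 ord0 j) by ring.
    apply: (le_trans (ler_normD _ _)).
    by have := hy j; have := px0 j; lra.
  - by apply: (le_trans zh); lra.
  rewrite ler_pM2r ?invr_gt0//.
  have -> : 2 * (n%:R + 1) * K * `|z| = (n%:R + 1) * K * (2 * `|z|) by ring.
  by rewrite ler_wpM2l ?mulr_ge0 ?(ltW K0) ?addr_ge0//; lra.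
have -> : u (pt m.+1) t1 - u x0 t1 = (u (pt m.+1) t1 - u (pt m) t1) + (u (pt m) t1 - u x0 t1) by ring.
apply: (le_trans (ler_normD _ _)).
have := IH (ltnW mn); move: L; rewrite -(natr1 m) mulrDl mul1r.
set a := (_ / rho); lra.
Qed.

Lemma interior_lower_bound (k : R) : (0 < n)%N -> 1 <= k ->
  exists2 th : R, 0 < th <= 1 & forall u x0 (t0 r M : R), C21_slab u ->
  0 < r -> 0 < M -> 0 < t0 - r ^+ 2 -> t0 < 16 ->
  (forall y t, in_cyl x0 t0 r y t -> 0 <= u y t <= k * M /\
    0 <= dt u y t - laplacian u y t <= k * M / r ^+ 2) ->
  u x0 t0 = M ->
  forall y t, (forall i, `|y ord0 i - x0 ord0 i| <= th * r) ->
    t0 - th * r ^+ 2 <= t <= t0 -> M / 4 <= u y t.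
Proof.
move=> n0 k1.
have nR : 1 <= n%:R :> R by rewrite (ler_nat _ 1).
(* With h = a r and rho = r / 4 the spatial modulus n (n + 1) K h / rho is exactly M / 4. [th] is
   chosen so that the barrier below rises by at most M / 8 in time th r^2. *)
pose a : R := (16 * n%:R * (n%:R + 1) * k)^-1.
pose th : R := a ^+ 2 / (32 * n%:R * k).
have D1 : 32 <= 16 * n%:R * (n%:R + 1) * k by nra.
have a0 : 0 < a by rewrite invr_gt0; lra.
have a32 : a <= 32^-1 by rewrite lef_pV2 ?posrE; lra.
have aE : 16 * n%:R * (n%:R + 1) * k * a = 1 by rewrite mulfV// gt_eqF//; lra.
have D2 : 32 <= 32 * n%:R * k by nra.
have th0 : 0 < th by rewrite divr_gt0 ?exprn_gt0//; lra.
have thE : 32 * n%:R * k * th = a ^+ 2.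
  by rewrite /th mulrCA mulfV ?mulr1// gt_eqF//; lra.
have tha : th <= a by nra.
exists th; first by apply/andP; split; lra.
move=> u x0 t0 r M Cu r0 M0 t00 t016 hyp uM.
have r20 : 0 < r ^+ 2 by rewrite exprn_gt0.
pose rho := r / 4; pose h := a * r; pose K := k * M.
have rho0 : 0 < rho by rewrite /rho; lra.
have rhoE : rho ^+ 2 = r ^+ 2 / 16 by rewrite /rho; field.
have K0 : 0 < K by rewrite mulr_gt0//; lra.
have KM : M <= K by rewrite ler_pMl.
have h0 : 0 < h by rewrite mulr_gt0.
have hr : h <= rho by rewrite /h /rho mulrC ler_pM2l//; lra.
have thr : th * r ^+ 2 <= r ^+ 2 / 32 by rewrite mulrC ler_pM2l//; lra.
have Kr : K / r ^+ 2 <= K / rho ^+ 2.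
  by rewrite ler_pM2l// lef_pV2 ?posrE ?rhoE; lra.
have modulus t1 x : t0 - th * r ^+ 2 <= t1 <= t0 ->
    (forall i, `|x ord0 i - x0 ord0 i| <= h) -> `|u x t1 - u x0 t1| <= M / 4.
  move=> /andP[ta tb] hx.
  apply: (le_trans (spatial_modulus u x0 t1 rho K h Cu rho0 K0 _ _ _ _ x hx)).
  - by rewrite rhoE; lra.
  - by lra.
  - move=> y t hy /andP[hta htb]; have [|h1 /andP[h2 h3]] := hyp y t.
      split; last by move: hta; rewrite rhoE => ?; apply/andP; split; lra.
      by move=> i; apply: (le_trans (hy i)); rewrite /rho; lra.
    by split => //; rewrite h2 (le_trans h3).
  - by rewrite (ltW h0) hr.
  rewrite le_eqVlt; apply/orP; left; apply/eqP.
  have -> : (n%:R + 1) * K * h / rho = 4 * (n%:R + 1) * k * a * M.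
    by rewrite /K /h /rho; field; rewrite gt_eqF.
  have -> : n%:R * (4 * (n%:R + 1) * k * a * M) = (16 * n%:R * (n%:R + 1) * k * a) * M / 4 by field.
  by rewrite aE mul1r.
have low t1 : t0 - th * r ^+ 2 <= t1 <= t0 -> M / 2 <= u x0 t1.
  (* If u(x0, t1) < M / 2, then u <= 3 M / 4 on the whole cube at time t1, and the barrier keeps
     u(x0, t0) below 3 M / 4 + M / 8 < M. *)
  move=> ht1; have /andP[ta tb] := ht1; rewrite leNgt; apply/negP => ult.
  have hle y : (forall i, `|y ord0 i - x0 ord0 i| <= h) -> u y t1 <= 3 * M / 4.
    by move=> hy; have := modulus _ _ ht1 hy; rewrite ler_norml => /andP[? ?]; lra.
  have [A AE] : exists A, A = K / h ^+ 2 by exists (K / h ^+ 2).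
  have h20 : 0 < h ^+ 2 by rewrite exprn_gt0.
  have A0 : 0 < A by rewrite AE divr_gt0.
  have Ah : A * h ^+ 2 = K by rewrite AE divfK// gt_eqF.
  have [F FE] : exists F, F = K / r ^+ 2 by exists (K / r ^+ 2).
  have F0 : 0 < F by rewrite FE divr_gt0.
  (* The barrier then has w_t - Laplacian w = 2 F, strictly above the source bound F. Its quadratic
     part reaches K on the sides of the cube, and its value at (x0, t1) is 3 M / 4. *)
  have [T TE] : exists T, T = 2 * A * n%:R + 2 * F by exists (2 * A * n%:R + 2 * F).
  have T0 : 0 < T.
    by rewrite TE addr_gt0 ?mulr_gt0//; lra.
  pose i0 := Ordinal n0.
  pose w := quad_barrier x0 i0 A 0 0 T (3 * M / 4 - T * t1).
  pose v y t := 1 * u y t + (- 1) * w y t.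
  have wE y t : w y t = A * (\sum_j (y ord0 j - x0 ord0 j) ^+ 2) + T * (t - t1) + 3 * M / 4.
    by rewrite /w /quad_barrier; ring.
  pose lo : 'rV[R]_n := \row_j (x0 ord0 j - h).
  pose hi : 'rV[R]_n := \row_j (x0 ord0 j + h).
  have box y : (forall j, lo ord0 j <= y ord0 j <= hi ord0 j) ->
      forall j, `|y ord0 j - x0 ord0 j| <= h.
    move=> hy j; have := hy j; rewrite !mxE ler_norml => /andP[? ?].
    by apply/andP; split; lra.
  have cyl y t : (forall j, lo ord0 j <= y ord0 j <= hi ord0 j) -> t1 <= t <= t0 ->
      in_cyl x0 t0 r y t.
    move=> hy /andP[? ?]; split; last by apply/andP; split; lra.
    by move=> j; apply: (le_trans (box _ hy j)); move: hr; rewrite /rho; lra.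
  have slab t : t1 <= t <= t0 -> 0 < t < 16.
    by move=> /andP[? ?]; apply/andP; split; lra.
  have S0 y : 0 <= \sum_j (y ord0 j - x0 ord0 j) ^+ 2.
    by apply: sumr_ge0 => j _; exact: sqr_ge0.
  have v0 : forall y t, (forall j, lo ord0 j <= y ord0 j <= hi ord0 j) ->
      t1 <= t <= t0 -> v y t <= 0.
    apply: parabolic_maximum_principle.
    - by move=> j; rewrite !mxE; lra.
    - by [].
    - move=> y t hy ht; rewrite /v /jcont.
      have cZ (c : R) (f : 'rV[R]_n -> R -> R) : jcont f y t ->
          {for (y, t), continuous (fun q => c * f q.1 q.2)}.
        by move=> cf; apply: cvgM => //; exact: cvg_cst.
      apply: cvgD; apply: cZ; last exact: quad_barrier_jcont.
      by have [] := Cu y t (slab _ ht).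
    - move=> y t hy ht hb.
      suff : u y t <= w y t by rewrite /v; lra.
      have [/andP[_ uK] _] := hyp _ _ (cyl _ _ hy ht).
      have /andP[t1t _] := ht.
      have AS : 0 <= A * \sum_j (y ord0 j - x0 ord0 j) ^+ 2.
        by rewrite mulr_ge0// ltW.
      have Tt : 0 <= T * (t - t1) by rewrite mulr_ge0 ?subr_ge0 ?(ltW T0).
      rewrite wE; case: hb => [[j yj]|tE]; last first.
        rewrite {1}tE; apply: (le_trans (hle y (box _ hy))); lra.
      have : A * h ^+ 2 <= A * \sum_j (y ord0 j - x0 ord0 j) ^+ 2.
        rewrite ler_pM2l//; apply: le_trans (sum_sqr_ge x0 y j).
        by case: yj => ->; rewrite !mxE le_eqVlt; apply/orP; left; apply/eqP; ring.
      by rewrite Ah; move: uK; rewrite -/K; lra.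
    - move=> y t hy ht.
      have hy' j : lo ord0 j <= y ord0 j <= hi ord0 j.
        by have /andP[? ?] := hy j; rewrite !ltW.
      have ht' : t1 <= t <= t0 by case/andP: ht => /ltW-> ->.
      have hs := slab _ ht'.
      have [_ /andP[_ hF]] := hyp _ _ (cyl _ _ hy' ht').
      rewrite -/K -FE in hF.
      exists (1 * dt u y t + (- 1) * T).
      exists (fun j => 1 * dx (dx u j) j y t + (- 1) * (2 * (A + 0 * (j == i0)%:R))); split.
      + have [_ [d1 _] _ _] := Cu y t hs.
        have D1' : is_derive t 1 (u y) (dt u y t) by exact: derivableP.
        have D3 := quad_barrier_dt x0 i0 A 0 0 T (3 * M / 4 - T * t1) y t.
        rewrite -/w in D3.
        exact: is_deriveD.
      + move=> j; apply: second_deriveD; last first.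
          by apply: second_deriveZ; exact: quad_barrier_d2.
        apply: second_deriveZ.
        have := second_derive_line u y t j 1 Cu hs.
        by rewrite expr1n mul1r; under eq_fun do rewrite mul1r.
      + under eq_bigr do rewrite mul0r addr0.
        rewrite big_split/= -mulr_sumr -/(laplacian u y t) sumr_const card_ord.
        rewrite -mulr_natr TE; lra.
  have H : u x0 t0 <= w x0 t0.
    suff : v x0 t0 <= 0 by rewrite /v; lra.
    apply: v0; last by apply/andP; split; lra.
    by move=> j; rewrite !mxE; apply/andP; split; lra.
  rewrite wE big1 ?mulr0 ?add0r ?uM in H; last first.
    by move=> j _; rewrite subrr expr0n.
  have T1 : T * (t0 - t1) <= T * (th * r ^+ 2) by rewrite ler_pM2l//; lra.
  have T2 : T * (th * r ^+ 2) = 2 * n%:R * k * th / a ^+ 2 * M + 2 * k * th * M.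
    by rewrite TE AE FE /K /h; field; rewrite !gt_eqF.
  have e1 : 2 * n%:R * k * th / a ^+ 2 = 16^-1.
    rewrite -thE; field; rewrite !gt_eqF//; lra.
  have e2 : 2 * k * th <= 16^-1.
    have : 2 * k * th * 16 <= 1.
      apply: (@le_trans _ _ (a ^+ 2)); last by nra.
      rewrite -thE; have kth : 0 <= k * th by apply: mulr_ge0; lra.
      have : 0 <= k * th * (n%:R - 1) by apply: mulr_ge0 => //; lra.
      by lra.
    by lra.
  have : 2 * k * th * M <= 16^-1 * M by rewrite ler_pM2r.
  by move: T2; rewrite e1; lra.
move=> y t hy ht.
have hy' i : `|y ord0 i - x0 ord0 i| <= h.
  by apply: (le_trans (hy i)); rewrite ler_pM2r.
have := low t ht; have := modulus _ _ ht hy'.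
by rewrite ler_norml => /andP[? ?] ?; lra.
Qed.

End interior_lower_bound.

(** * The nonlinear potential *)

Section potential.
Context {R : realType}.
Local Notation mu := (@lebesgue_measure R).

Lemma is_derive_powR_sub (t e s : R) : s < t ->
  is_derive s 1 (fun r => powR (t - r) e) (- (e * powR (t - s) (e - 1))).
Proof.
move=> st.
have D1 : is_derive (t - s) 1 (powR (R:=R) ^~ e) (e * powR (t - s) (e - 1)).
  by apply: is_derive1_powR; rewrite subr_gt0.
have D2 : is_derive s 1 (fun r : R => t - r) (- 1).
  by apply: is_derive_eq; ring.
have := @is_derive1_comp _ (powR (R:=R) ^~ e) (fun r : R => t - r) s _ _ D1 D2.
by rewrite mulrN1.
Qed.

(** For e < 0 the integrand is singular at s = t, so the primitive is used on intervals stopping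
    short of t, followed by monotone convergence. The denominators start at 2 to keep these
    intervals nondegenerate. *)
Lemma integral_powR_sub_le (t b e : R) : 0 < b -> -1 < e ->
  (\int[mu]_(s in `[(t - b)%R, t[) (powR (t - s) e)%:E <= (powR b (e + 1) / (e + 1))%:E)%E.
Proof.
move=> b0 e1.
have e10 : 0 < e + 1 by lra.
have cvg_F : (\int[mu]_(s in `[(t - b)%R, (t - b / k.+2%:R)%R]) (powR (t - s) e)%:E
    @[k --> \oo] --> \int[mu]_(s in `[(t - b)%R, t[) (powR (t - s) e)%:E)%E.
  have -> : `[(t - b)%R, t[%classic = \bigcup_k `[(t - b)%R, (t - b / k.+2%:R)%R]%classic.
    apply/seteqP; split => s /=.
      rewrite in_itv/= => /andP[s1 s2].
      pose m := Num.trunc (b / (t - s)).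
      have ts0 : 0 < t - s by rewrite subr_gt0.
      exists m => //=; rewrite in_itv/= s1/=.
      rewrite lerBrDl -lerBrDr ler_pdivrMr//.
      rewrite -ler_pdivrMl// mulrC.
      apply: (@le_trans _ _ m.+1%:R); last by rewrite ler_nat.
      by apply/ltW; exact: truncnS_gt.
    move=> [k _] /=; rewrite !in_itv/= => /andP[-> sk] /=.
    by apply: (le_lt_trans sk); rewrite ltrBlDr ltrDl divr_gt0.
  apply: ge0_nondecreasing_set_cvg_integral.
  - move=> k m km; apply/subsetPset => s /=; rewrite !in_itv/= => /andP[-> sk] /=.
    apply: (le_trans sk); rewrite lerB// ler_pM2l// lef_pV2 ?posrE// ler_nat.
    by rewrite !ltnS.
  - by move=> i; exact: measurable_itv.
  - move=> i; apply: measurable_funTS; apply/measurable_EFinP.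
    apply: (@measurableT_comp _ _ _ _ _ _ (powR (R:=R) ^~ e)).
      exact: measurable_powR.
    by apply: measurable_funB => //; exact: measurable_id.
  - by move=> i x _; rewrite lee_fin powR_ge0.
apply: cvge_le cvg_F.
apply: nearW => k.
set c := t - b / k.+2%:R.
have ct : c < t by rewrite /c ltrBlDr ltrDl divr_gt0.
have bc : t - b < c.
  rewrite /c ltrD2l ltrN2 gtr_pMr// invf_lt1// (ltr_nat _ 1).
  by [].
pose F s := - (e + 1)^-1 * powR (t - s) (e + 1).
have dF (s : R) : s < t -> is_derive s 1 F (powR (t - s) e).
  move=> st; have D := is_derive_powR_sub t (e + 1) s st.
  have D' : is_derive s 1 F _ :=
    @is_deriveZ _ _ _ (fun r => powR (t - r) (e + 1)) (- (e + 1)^-1) s 1 _ D.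
  apply: (is_derive_eq D').
  by rewrite addrK /GRing.scale/=; field; rewrite gt_eqF.
have cF s : s < t -> {for s, continuous F}.
  move=> /dF [dFs _]; apply: differentiable_continuous.
  exact/derivable1_diffP.
rewrite (@continuous_FTC2 _ (fun s => powR (t - s) e) F)//.
- rewrite -EFinB lee_fin /F.
  have -> : t - (t - b) = b by ring.
  have : 0 <= (e + 1)^-1 * powR (t - c) (e + 1).
    by rewrite mulr_ge0 ?powR_ge0// invr_ge0 ltW.
  by set X := powR b _; lra.
- apply: derivable_within_continuous => s; rewrite in_itv/= => /andP[_ sc].
  by have [] := is_derive_powR_sub t e s (le_lt_trans sc ct).
- split.
  + move=> s; rewrite in_itv/= => /andP[_ sc].
    by have [] := dF s (lt_trans sc ct).
  + by apply: cvg_at_right_filter; apply: cF; exact: lt_trans bc ct.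
  + by apply: cvg_at_left_filter; exact: cF.
- move=> s; rewrite in_itv/= => /andP[_ sc].
  by rewrite derive1E; have [_ ->] := dF s (lt_trans sc ct).
Qed.

Lemma integral_normal_fun (m s : R) : s != 0 ->
  (\int[mu]_a (normal_fun m s a)%:E = (Num.sqrt (s ^+ 2 * pi *+ 2))%:E)%E.
Proof.
move=> s0.
have := integral_normal_pdf m s; rewrite normal_pdfE//.
have p0 := normal_peak_gt0 s0.
rewrite ge0_integralZl_EFinr//; last 3 first.
- exact: measurable_normal_fun.
- by move=> x _; exact: normal_fun_ge0.
- exact: ltW.
move=> /(congr1 (fun z => (normal_peak s)^-1%:E * z)%E).
rewrite muleA -EFinM mulVf ?gt_eqF// mul1e mule1 => ->.
by rewrite /normal_peak invrK.
Qed.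

Lemma powR_expR (x y : R) : powR (expR x) y = expR (x * y).
Proof. by rewrite /powR gt_eqF ?expR_gt0// expRK mulrC. Qed.

Lemma enorm_sqr n (z : 'rV[R]_n) : enorm z ^+ 2 = \sum_(i < n) z ord0 i ^+ 2.
Proof. by rewrite sqr_sqrtr// sumr_ge0// => i _; exact: sqr_ge0. Qed.

Lemma heat_kernel_powR n (alpha tau : R) (z : 'rV[R]_n) : (0 < n)%N -> 0 < tau ->
  powR (heat_kernel z tau) (alpha / n%:R) =
  powR (4 * pi * tau) (- (alpha / 2)) *
    expR (- (enorm z ^+ 2) / (4 * tau) * (alpha / n%:R)).
Proof.
move=> n0 tau0; rewrite /heat_kernel tau0.
rewrite powRM ?powR_ge0 ?expR_ge0// -powRrM powR_expR.
congr (powR _ _ * _); field.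
by rewrite pnatr_eq0 -lt0n n0.
Qed.

(** The left side is X^(alpha / 2) with X = exp(-|z|^2 / (2 n tau)) / (4 pi tau), so X <= n / rho^2
    is enough. For tau >= rho^2 the prefactor gives this; for |z| >= rho, exp(-y) <= 1 / y at y =
    rho^2 / (2 n tau) cancels the factor 1 / tau. *)
Lemma heat_kernel_off_cyl n (alpha tau rho : R) (z : 'rV[R]_n) :
  (0 < n)%N -> 0 < alpha -> 0 < rho -> 0 < tau ->
  rho ^+ 2 <= tau \/ (exists j, rho < `|z ord0 j|) ->
  powR (heat_kernel z tau) (alpha / n%:R) <=
    powR n%:R (alpha / 2) * powR rho (- alpha).
Proof.
move=> n0 alpha0 rho0 tau0 off.
have nR : 1 <= n%:R :> R by rewrite (ler_nat _ 1).
have pi2 := pi_ge2 R.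
have pt0 : 0 < 4 * pi * tau by rewrite !mulr_gt0// pi_gt0.
pose X := (4 * pi * tau)^-1 * expR (- (enorm z ^+ 2) / (2 * n%:R * tau)).
have rho20 : 0 < rho ^+ 2 by rewrite exprn_gt0.
have -> : powR (heat_kernel z tau) (alpha / n%:R) = powR X (alpha / 2).
  rewrite heat_kernel_powR// /X [RHS]powRM ?invr_ge0 ?expR_ge0 ?(ltW pt0)//.
  rewrite powR_expR; congr (_ * expR _).
    by rewrite -[(4 * pi * tau)^-1]powR_inv1 ?(ltW pt0)// -powRrM mulN1r.
  by field; rewrite !gt_eqF//; lra.
have -> : powR n%:R (alpha / 2) * powR rho (- alpha) = powR (n%:R / rho ^+ 2) (alpha / 2).
  rewrite [RHS]powRM ?invr_ge0 ?(ltW rho20)//; congr (_ * _).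
  rewrite -[(rho ^+ 2)^-1]powR_inv1 ?(ltW rho20)// -powRrM -powR_mulrn ?(ltW rho0)// -powRrM.
  by congr powR; field.
have X0 : 0 <= X by rewrite mulr_ge0 ?expR_ge0// invr_ge0 ltW.
have N0 : 0 <= n%:R / rho ^+ 2 by rewrite divr_ge0// ltW.
apply: ge0_ler_powR => //; first by rewrite divr_ge0// ltW.
have E0 : 0 <= enorm z ^+ 2 by rewrite sqr_ge0.
have [rt|[j zj]] := off.
  apply: (@le_trans _ _ (4 * pi * tau)^-1).
    rewrite /X ger_pMr ?invr_gt0// -expR0 ler_expR mulNr oppr_le0.
    by rewrite divr_ge0// !mulr_ge0//; lra.
  apply: (@le_trans _ _ (rho ^+ 2)^-1).
    rewrite lef_pV2 ?posrE//; apply: (le_trans rt).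
    by rewrite ler_pMl//; lra.
  by rewrite ler_pMl ?invr_gt0.
have zr : rho ^+ 2 <= enorm z ^+ 2.
  rewrite enorm_sqr (bigD1 j)//=.
  apply: (@le_trans _ _ (z ord0 j ^+ 2)).
    by rewrite -[leRHS]real_normK ?num_real// lerXn2r ?nnegrE ?(ltW rho0)// ltW.
  by rewrite lerDl sumr_ge0// => k _; exact: sqr_ge0.
pose y := rho ^+ 2 / (2 * n%:R * tau).
have nt0 : 0 < 2 * n%:R * tau by rewrite !mulr_gt0//; lra.
have y0 : 0 < y by rewrite divr_gt0.
have ey : expR (- (enorm z ^+ 2) / (2 * n%:R * tau)) <= y^-1.
  apply: (@le_trans _ _ (expR (- y))).
    by rewrite ler_expR /y mulNr lerN2 ler_pM2r ?invr_gt0.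
  rewrite expRN lef_pV2 ?posrE ?expR_gt0//.
  by apply: le_trans (expR_ge1Dx y); lra.
apply: (@le_trans _ _ ((4 * pi * tau)^-1 * y^-1)).
  by rewrite /X ler_pM2l ?invr_gt0.
have -> : (4 * pi * tau)^-1 * y^-1 = n%:R / rho ^+ 2 * (2 * pi)^-1.
  by rewrite /y; field; rewrite !gt_eqF//; lra.
rewrite ler_piMr//.
by rewrite invf_le1; lra.
Qed.

(** The power alpha / n changes the variance of each coordinate from 2 tau to 2 n tau / alpha. *)
Lemma heat_kernel_prod n (alpha tau : R) (x y : 'rV[R]_n) :
  (0 < n)%N -> 0 < alpha -> 0 < tau ->
  powR (heat_kernel (x - y) tau) (alpha / n%:R) =
  powR (4 * pi * tau) (- (alpha / 2)) *
  \prod_(i < n) normal_fun (x ord0 i) (Num.sqrt (2 * n%:R * tau / alpha)) (y ord0 i).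
Proof.
move=> n0 alpha0 tau0; rewrite heat_kernel_powR//; congr (_ * _).
have nR : 0 < n%:R :> R by rewrite ltr0n.
have s2 : Num.sqrt (2 * n%:R * tau / alpha) ^+ 2 = 2 * n%:R * tau / alpha.
  by rewrite sqr_sqrtr// divr_ge0 ?mulr_ge0// ltW.
rewrite /normal_fun -expR_sum; congr expR.
rewrite enorm_sqr -sumrN !mulr_suml; apply: eq_bigr => i _.
by rewrite s2 !mxE; field; rewrite !gt_eqF.
Qed.

End potential.

(** * Splitting of the potential into near and far parts *)

Section potential_bound.
Context {R : realType} {n : nat}.
Local Notation mu := (@lebesgue_measure R).
Implicit Types (u : 'rV[R]_n -> R -> R) (x y : 'rV[R]_n).

(** Up to the factor tau^((n - alpha) / 2), this is the integral over R^n of the kernel at time tau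
    to the power alpha / n. *)
Let Ck (alpha : R) : R :=
  powR (4 * pi) (- (alpha / 2)) * powR (4 * pi * n%:R / alpha) (n%:R / 2).

Let Ck_ge0 alpha : 0 <= Ck alpha.
Proof. by rewrite mulr_ge0 ?powR_ge0. Qed.

(** In the pointwise hypothesis the first summand dominates near [x] and the second far away.
    Keeping their sum everywhere avoids cutting R^n into two regions. *)
Let int_Rn_kernel_le (alpha tau L c : R) (f : 'rV[R]_n -> R) x :
  (0 < n)%N -> 0 < alpha -> 0 < tau -> 0 <= L -> 0 < c ->
  (forall y, 0 <= f y) ->
  (forall y, powR (heat_kernel (x - y) tau) (alpha / n%:R) * f y <=
    powR (heat_kernel (x - y) tau) (alpha / n%:R) * L + c * f y) ->
  (int_Rn (fun y => (powR (heat_kernel (x - y) tau) (alpha / n%:R) * f y)%:E)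
    <= (L * Ck alpha * powR tau ((n%:R - alpha) / 2))%:E
       + c%:E * int_Rn (fun y => (f y)%:E))%E.
Proof.
move=> n0 alpha0 tau0 L0 c0 f0 fL.
have nR : 0 < n%:R :> R by rewrite ltr0n.
have pi0 := pi_gt0 R.
pose s := Num.sqrt (2 * n%:R * tau / alpha).
have s20 : 0 < 2 * n%:R * tau / alpha by rewrite divr_gt0 ?mulr_gt0.
have s0 : s != 0 by rewrite sqrtr_eq0 -ltNge.
have s2 : s ^+ 2 = 2 * n%:R * tau / alpha by rewrite sqr_sqrtr// ltW.
pose a := L * powR (4 * pi * tau) (- (alpha / 2)).
pose J := Num.sqrt (s ^+ 2 * pi *+ 2).
have a0 : 0 <= a by rewrite mulr_ge0 ?powR_ge0.
have cf0 y : (0 <= c%:E * (f y)%:E)%E by rewrite -EFinM lee_fin mulr_ge0 ?(ltW c0).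
have aJ : a * J ^+ n = L * Ck alpha * powR tau ((n%:R - alpha) / 2).
  have -> : J ^+ n = powR (4 * pi * n%:R / alpha * tau) (n%:R / 2).
    have -> : 4 * pi * n%:R / alpha * tau = s ^+ 2 * pi *+ 2.
      by rewrite s2; field; rewrite gt_eqF.
    have X0 : 0 <= s ^+ 2 * pi *+ 2 by rewrite mulrn_wge0// mulr_ge0 ?sqr_ge0// ltW.
    by rewrite [n%:R / 2]mulrC powRrM powR12_sqrt// powR_mulrn.
  rewrite /a /Ck (powRM _ (mulr_ge0 _ (ltW pi0)) (ltW tau0))//.
  rewrite (powRM _ _ (ltW tau0)); last by rewrite divr_ge0 ?mulr_ge0 ?(ltW pi0)// ltW.
  have -> : (n%:R - alpha) / 2 = - (alpha / 2) + n%:R / 2 by field.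
  rewrite [powR tau (_ + _)]powRD; last by rewrite (gt_eqF tau0) implybT.
  by ring.
apply: (@le_trans _ _ (int_Rn (fun y => (a * \prod_(i < n) normal_fun (x ord0 i) s (y ord0 i))%:E
    + c%:E * (f y)%:E))%E).
  apply: le_int_Rn => y; first by rewrite lee_fin mulr_ge0 ?powR_ge0.
  rewrite -EFinM -EFinD lee_fin; apply: (le_trans (fL y)).
  by rewrite heat_kernel_prod// -/s /a lerD2r mulrC mulrA.
apply: (le_trans (int_Rn_prodD_le n a J (fun i => normal_fun (x ord0 i) s)
  (fun y => c%:E * (f y)%:E)%E a0 _ _ _ _ cf0)).
- exact: sqrtr_ge0.
- by move=> i; exact: measurable_normal_fun.
- by move=> i b; exact: normal_fun_ge0.
- by move=> i; rewrite integral_normal_fun.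
by rewrite aJ leeD2l//; apply: int_RnZ_le.
Qed.

Lemma potential_bound (alpha lambda : R) : (0 < n)%N -> 0 < alpha < n%:R + 2 ->
  0 < lambda -> exists C1 C2 : R, [/\ 0 <= C1, 0 < C2 &
  forall u x (t rho K : R), 0 < rho -> 0 <= K ->
  (forall y s, 0 < s < 16 -> 0 <= u y s) ->
  (forall y s, 0 < s < 16 -> in_cyl x t rho y s -> u y s <= K) ->
  (int_slab (fun y s => (powR (heat_kernel (x - y) (t - s)) (alpha / n%:R)
     * powR (u y s) lambda)%:E) <=
   (C1 * powR K lambda * powR rho (n%:R + 2 - alpha))%:E +
   (C2 * powR rho (- alpha))%:E * int_slab (fun y s => (powR (u y s) lambda)%:E))%E].
Proof.
move=> n0 /andP[alpha0 alphan] lam0.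
pose e := (n%:R - alpha) / 2.
have e1 : 0 < e + 1 by rewrite /e; lra.
have nR : 0 < n%:R :> R by rewrite ltr0n.
exists (Ck alpha / (e + 1)), (powR n%:R (alpha / 2)); split.
- by rewrite divr_ge0 ?Ck_ge0// ltW.
- by rewrite powR_gt0.
move=> u x t rho K rho0 K0 u0 uK.
set c := powR n%:R (alpha / 2) * powR rho (- alpha).
have c0 : 0 < c by rewrite mulr_gt0 ?powR_gt0.
pose L := powR K lambda.
have L0 : 0 <= L by exact: powR_ge0.
(* [G] dominates the near part. It is integrable up to s = t because alpha < n + 2 means e > -1, and
   its integral over [t - rho^2, t[ scales like rho^(2 (e + 1)) = rho^(n + 2 - alpha). *)
pose G s := L * Ck alpha * (powR (t - s) e * \1_(`[t - rho ^+ 2, t[%classic) s).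
have G0 s : 0 <= G s by rewrite !mulr_ge0 ?powR_ge0 ?Ck_ge0.
have mp : measurable_fun setT (fun s : R => powR (t - s) e).
  apply: (@measurableT_comp _ _ _ _ _ _ (powR (R:=R) ^~ e)).
    exact: measurable_powR.
  by apply: measurable_funB => //; exact: measurable_id.
have mG1 : measurable_fun setT (fun s : R => powR (t - s) e * \1_(`[t - rho ^+ 2, t[%classic) s).
  by apply: measurable_funM => //; exact: measurable_indic.
have mG : measurable_fun setT G by exact: measurable_funM.
pose phi s := int_Rn (fun y => (powR (u y s) lambda)%:E).
have phi0 s : (0 <= phi s)%E by apply: int_Rn_ge0 => y; rewrite lee_fin powR_ge0.
have IG : (\int[mu]_(s in `]0%R, 16%R[) (G s)%:E <=
    (Ck alpha / (e + 1) * L * powR rho (n%:R + 2 - alpha))%:E)%E.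
  have LC0 : 0 <= L * Ck alpha by rewrite mulr_ge0 ?Ck_ge0.
  apply: (@le_trans _ _ ((L * Ck alpha)%:E * \int[mu]_(s in `[(t - rho ^+ 2)%R, t[) (powR (t - s) e)%:E)%E).
    rewrite -ge0_integralZl_EFinr//; last 2 first.
    - exact: measurable_funTS.
    - by move=> s _; exact: powR_ge0.
    rewrite [leRHS]integral_mkcond; apply: ge0_le_integral_nm => s _.
    - by rewrite lee_fin.
    - by apply: erestrict_ge0 => r _; rewrite lee_fin mulr_ge0 ?powR_ge0.
    split => //; rewrite /G /patch indicE.
    by case: ifPn => _; rewrite ?mulr1 ?mulr0.
  have := integral_powR_sub_le t (rho ^+ 2) e _ _.
  move=> H; apply: (le_trans (lee_wpmul2l _ (H _ _))).
  - by rewrite lee_fin.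
  - by rewrite exprn_gt0.
  - by move: e1; lra.
  rewrite -EFinM lee_fin -powR_mulrn ?(ltW rho0)// -powRrM.
  have -> : 2 * (e + 1) = n%:R + 2 - alpha by rewrite /e; field.
  by rewrite le_eqVlt; apply/orP; left; apply/eqP; ring.
rewrite /int_slab.
apply: (@le_trans _ _ (\int[mu]_(s in `]0%R, 16%R[) ((G s)%:E + c%:E * phi s))%E).
  apply: ge0_le_integral_nm => s.
  - by move=> _; apply: int_Rn_ge0 => y; rewrite lee_fin mulr_ge0 ?powR_ge0.
  - by move=> _; rewrite adde_ge0 ?lee_fin// mule_ge0// lee_fin ltW.
  rewrite /= in_itv/= => hs; split => //.
  have f0 y : 0 <= powR (u y s) lambda by exact: powR_ge0.
  have offl : (forall y, powR (heat_kernel (x - y) (t - s)) (alpha / n%:R) <= c) ->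
      (int_Rn (fun y => (powR (heat_kernel (x - y) (t - s)) (alpha / n%:R)
        * powR (u y s) lambda)%:E) <= (G s)%:E + c%:E * phi s)%E.
    move=> kc; apply: (@le_trans _ _ (c%:E * phi s)%E); last by rewrite leeDr// lee_fin.
    apply: (@le_trans _ _ (int_Rn (fun y => (c%:E * (powR (u y s) lambda)%:E)%E))).
      apply: le_int_Rn => y; first by rewrite lee_fin mulr_ge0 ?powR_ge0.
      by rewrite -EFinM lee_fin ler_wpM2r.
    by apply: int_RnZ_le => // y; rewrite lee_fin.
  (* For s >= t the kernel is 0, and so is its power since the exponent alpha / n is nonzero. *)
  have [st|ts] := ltP s t; last first.
    apply: offl => y; rewrite /heat_kernel ifN ?subr_gt0 -?leNgt//.
    by rewrite powR0 ?(ltW c0)// mulf_neq0 ?invr_eq0 ?gt_eqF.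
  have tau0 : 0 < t - s by rewrite subr_gt0.
  have [rt|tr] := leP (rho ^+ 2) (t - s).
    by apply: offl => y; apply: heat_kernel_off_cyl => //; left.
  have -> : G s = L * Ck alpha * powR (t - s) ((n%:R - alpha) / 2).
    rewrite /G indicE mem_set ?mulr1//= in_itv/= st andbT.
    by move: tr; lra.
  apply: int_Rn_kernel_le => // y.
  set k := powR (heat_kernel _ _) _.
  have k0 : 0 <= k by exact: powR_ge0.
  have [[j zj]|/forallNP near] := pselect (exists j, rho < `|(x - y) ord0 j|).
    have kc : k <= c by apply: heat_kernel_off_cyl => //; right; exists j.
    apply: (@le_trans _ _ (c * powR (u y s) lambda)); first by rewrite ler_wpM2r.
    by rewrite lerDr mulr_ge0.
  apply: (@le_trans _ _ (k * L)); last by rewrite lerDl mulr_ge0// ltW.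
  rewrite ler_wpM2l// ge0_ler_powR// ?nnegrE ?(ltW lam0)//; first exact: u0.
  apply: uK => //; split; last by apply/andP; split; lra.
  move=> i; have /negP := near i; rewrite -leNgt => h.
  by rewrite distrC; move: h; rewrite !mxE.
apply: (le_trans (ge0_integralD_le_nm mu _ G (fun s => c%:E * phi s)%E _ _ _ _)).
- exact: measurable_itv.
- exact: measurable_funTS.
- by move=> s _.
- by move=> s _; rewrite mule_ge0// lee_fin ltW.
apply: leeD => //.
apply: ge0_integralZl_le_nm => //.
Qed.

End potential_bound.

(** * Doubling and conclusion *)

Section doubling.
Context {R : realType} {n : nat}.
Implicit Types (u : 'rV[R]_n -> R -> R) (x y : 'rV[R]_n).

Lemma in_cyl_bounded u x (t r : R) : C21_slab u -> 0 < r ->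
  0 < t - r ^+ 2 -> t < 16 ->
  exists B, forall y s, in_cyl x t r y s -> u y s <= B.
Proof.
move=> Cu r0 t0 t16.
pose A : set 'rV[R]_n :=
  [set y | forall i, `[x ord0 i - r, x ord0 i + r]%classic (y ord0 i)].
pose D : set ('rV[R]_n * R) := A `*` `[t - r ^+ 2, t].
have r20 : 0 < r ^+ 2 by rewrite exprn_gt0.
have cA : compact A.
  apply: (@rV_compact _ _ (fun i => `[x ord0 i - r, x ord0 i + r]%classic)) => i.
  exact: segment_compact.
have cD : compact D by apply: compact_setX => //; exact: segment_compact.
have DQ y s : in_cyl x t r y s -> D (y, s).
  move=> [hy hs]; split; last by rewrite /= in_itv.
  move=> i; rewrite /= in_itv/=; have := hy i; rewrite ler_norml => /andP[? ?].
  by apply/andP; split; lra.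
have D0 : D !=set0.
  exists (x, t); apply: DQ; split; last by apply/andP; split; lra.
  by move=> i; rewrite subrr normr0 ltW.
have cuD : {within D, continuous (fun q : 'rV[R]_n * R => u q.1 q.2)}.
  apply: continuous_in_subspaceT => -[y s]; rewrite inE => -[_] /=.
  rewrite in_itv/= => /andP[s1 s2].
  have hs : 0 < s < 16 by apply/andP; split; lra.
  by have [] := Cu y s hs.
have [[y0 s0] _ umax] := compact_EVT_max D0 cD cuD.
exists (u y0 s0) => y s hy; apply: (umax (y, s)); rewrite inE; exact: DQ.
Qed.

Lemma in_cyl_center x (t r : R) : 0 <= r -> in_cyl x t r x t.
Proof.
move=> r0; split; first by move=> i; rewrite subrr normr0.
by apply/andP; split => //; rewrite gerBl sqr_ge0.
Qed.

Lemma in_cyl_corner x (t r : R) : 0 <= r -> in_cyl x t r x (t - r ^+ 2).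
Proof.
move=> r0; split; first by move=> i; rewrite subrr normr0.
by apply/andP; split => //; rewrite gerBl sqr_ge0.
Qed.

Lemma in_cyl_half_trans x y z (t s w r : R) :
  in_cyl x t (r / 2) y s -> in_cyl y s (r / 2) z w -> in_cyl x t r z w.
Proof.
have E : (r / 2) ^+ 2 = r ^+ 2 / 4 by field.
move=> [h1 /andP[h2 h3]] [h4 /andP[h5 h6]]; rewrite E in h2 h5; split.
  move=> i; have -> : z ord0 i - x ord0 i = (z ord0 i - y ord0 i) + (y ord0 i - x ord0 i) by ring.
  have := ler_normD (z ord0 i - y ord0 i) (y ord0 i - x ord0 i).
  by have := h1 i; have := h4 i; lra.
by have := sqr_ge0 r; move=> ?; apply/andP; split; lra.
Qed.

(* Nearly maximising [rho^gamma u(y, s)] over the cylinders of radius [rho]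
   contained in a given one yields a cylinder on which [u] is comparable to its
   value at the top centre; shrinking it makes [r^gamma u(y, s)] a constant. *)
Lemma doubling u x (t R0 gamma e1 : R) : C21_slab u -> 0 < gamma -> 0 < R0 ->
  0 < t - R0 ^+ 2 -> t < 16 -> (forall y s, 0 < s < 16 -> 0 <= u y s) ->
  0 < e1 -> e1 < powR R0 gamma * u x t ->
  exists y s r, [/\ 0 < r <= R0, 0 < u y s,
    powR r gamma * u y s = e1 / 2 * powR 2 (- gamma),
    forall y' s', in_cyl y s r y' s' -> in_cyl x t R0 y' s' &
    forall y' s', in_cyl y s r y' s' -> u y' s' <= 2 * powR 2 gamma * u y s].
Proof.
move=> Cu g0 R00 t0 t16 u0 e10 e1u.
have R20 : 0 < R0 ^+ 2 by rewrite exprn_gt0.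
pose idx y s rho := [/\ 0 < rho, forall i, `|y ord0 i - x ord0 i| + rho <= R0,
  t - R0 ^+ 2 <= s - rho ^+ 2 & s <= t].
pose S : set R := [set z | exists y s rho, idx y s rho /\ z = powR rho gamma * u y s].
have idx_cyl y s rho : idx y s rho -> in_cyl x t R0 y s.
  move=> [rho0 h1 h2 h3]; split.
    by move=> i; have := h1 i; lra.
  by apply/andP; split => //; have := sqr_ge0 rho; lra.
have idx_le y s rho : idx y s rho -> rho <= R0.
  move=> [rho0 h1 h2 h3].
  rewrite -(@ler_pXn2r _ 2) ?nnegrE ?(ltW rho0) ?(ltW R00)//; lra.
have slab y s : in_cyl x t R0 y s -> 0 < s < 16.
  by move=> [_ /andP[? ?]]; apply/andP; split; lra.
have [B uB] := in_cyl_bounded u x t R0 Cu R00 t0 t16.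
have Sx : S (powR R0 gamma * u x t).
  exists x, t, R0; split => //; split => //; first by move=> i; rewrite subrr normr0 add0r.
have hS : has_sup S.
  split; first by exists (powR R0 gamma * u x t).
  exists (powR R0 gamma * B) => _ [y [s [rho [hi ->]]]].
  have hc := idx_cyl _ _ _ hi; have [rho0 _ _ _] := hi.
  apply: ler_pM; rewrite ?powR_ge0//; [exact: u0 (slab _ _ hc)| |exact: uB].
  by apply: ge0_ler_powR; rewrite ?nnegrE ?(ltW g0) ?(ltW rho0) ?(ltW R00) ?(idx_le _ _ _ hi).
have m1 : e1 < sup S by exact: lt_le_trans e1u (sup_upper_bound hS Sx).
have m0 : 0 < sup S / 2 by lra.
have [_ [y [s [rho [hi ->]]]] hm] := sup_adherent m0 hS.
have {}hm : sup S < 2 * (powR rho gamma * u y s) by lra.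
have [rho0 h1 h2 h3] := hi.
have prho : 0 < powR rho gamma by rewrite powR_gt0.
have M0 : 0 < u y s.
  rewrite -(pmulr_rgt0 _ prho).
  by lra.
have p2 : 0 < powR 2 gamma :> R by rewrite powR_gt0.
have half : powR (rho / 2) gamma = powR rho gamma / powR 2 gamma.
  rewrite powRM ?invr_ge0 ?(ltW rho0)//; congr (_ * _).
  by rewrite -[2^-1]powR_inv1// -powRrM mulN1r powRN.
pose e2 := e1 / 2 * powR 2 (- gamma).
have e20 : 0 < e2 by rewrite /e2 mulr_gt0 ?powR_gt0//; lra.
(* Solves r^gamma u(y, s) = e2. Since rho^gamma u(y, s) > sup S / 2 > e1 / 2 = 2^gamma e2, this
   radius is at most rho / 2. *)
pose r := powR (e2 / u y s) gamma^-1.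
have r0 : 0 < r by rewrite powR_gt0// divr_gt0.
have rg : powR r gamma = e2 / u y s.
  by rewrite /r -powRrM mulVf ?gt_eqF// powRr1// divr_ge0// ltW.
have rr : r <= rho / 2.
  rewrite leNgt; apply/negP => rlt.
  have : powR (rho / 2) gamma < powR r gamma.
    by apply: gt0_ltr_powR; rewrite ?nnegrE// ?divr_ge0 ?(ltW rho0) ?(ltW r0).
  rewrite rg ltr_pdivlMr// half /e2 powRN mulrAC ltr_pM2r ?invr_gt0//.
  by lra.
have rR : r <= R0 by apply: (le_trans rr); have := idx_le _ _ _ hi; lra.
have r2 : r ^+ 2 <= rho ^+ 2 / 4.
  have -> : rho ^+ 2 / 4 = (rho / 2) ^+ 2 by field.
  by rewrite lerXn2r ?nnegrE// ?(ltW r0)//; lra.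
have rho20 : 0 < rho ^+ 2 by rewrite exprn_gt0.
(* Each point of the small cylinder is the top centre of a cylinder of radius rho / 2 inside the big
   one, hence competes in the supremum. The halved radius costs 2^gamma, near-maximality costs 2. *)
have sub y' s' : in_cyl y s r y' s' -> idx y' s' (rho / 2).
  move=> [hy /andP[hs1 hs2]]; split.
  - by lra.
  - move=> i; have -> : y' ord0 i - x ord0 i = (y' ord0 i - y ord0 i) + (y ord0 i - x ord0 i) by ring.
    have := ler_normD (y' ord0 i - y ord0 i) (y ord0 i - x ord0 i).
    by have := hy i; have := h1 i; lra.
  - have -> : (rho / 2) ^+ 2 = rho ^+ 2 / 4 by field.
    by lra.
  - by lra.
exists y, s, r; split => //.
- by rewrite r0.
- by rewrite rg divfK// gt_eqF.
- by move=> y' s' /sub; exact: idx_cyl.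
move=> y' s' /sub hi'.
have : powR (rho / 2) gamma * u y' s' < 2 * (powR rho gamma * u y s).
  by apply: le_lt_trans hm; apply: (sup_upper_bound hS); exists y', s', (rho / 2).
rewrite half mulrAC ltr_pdivrMr// => H.
rewrite -(ler_pM2l prho).
have -> : powR rho gamma * (2 * powR 2 gamma * u y s) = 2 * (powR rho gamma * u y s) * powR 2 gamma by ring.
exact: ltW.
Qed.

(** The factor n converts a coordinatewise bound into |y - x| <= 1; then |y|^2 <= 2 |x|^2 + 2 |y -
    x|^2 <= 4. *)
Lemma enorm_lt4 x y : enorm x <= 1 ->
  (forall i, n%:R * (y ord0 i - x ord0 i) ^+ 2 <= 1) -> enorm y < 4.
Proof.
move=> x1 hy.
have : enorm y ^+ 2 <= 4.
  rewrite enorm_sqr.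
  apply: (@le_trans _ _ (\sum_i (2 * x ord0 i ^+ 2 + 2 * (y ord0 i - x ord0 i) ^+ 2))).
    apply: ler_sum => i _; have := sqr_ge0 (x ord0 i - (y ord0 i - x ord0 i)).
    by move: (x ord0 i) (y ord0 i) => a b; nra.
  rewrite big_split/= -!mulr_sumr -enorm_sqr.
  have e0 : 0 <= enorm x by exact: sqrtr_ge0.
  have : enorm x ^+ 2 <= 1 by rewrite expr_le1.
  suff : \sum_i (y ord0 i - x ord0 i) ^+ 2 <= 1 by lra.
  have [n0|n0] := posnP n.
    by rewrite big1 ?ler01// => i; have := ltn_ord i; rewrite [X in (_ < X)%N]n0.
  have nR : 0 < n%:R :> R by rewrite ltr0n.
  apply: (@le_trans _ _ (\sum_(i < n) n%:R^-1)).
    by apply: ler_sum => i _; rewrite -[leRHS]mul1r ler_pdivlMr// mulrC.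
  by rewrite sumr_const card_ord -(mulr_natr n%:R^-1 n) mulVf// gt_eqF.
move=> H; have e0 : 0 <= enorm y by exact: sqrtr_ge0.
by rewrite ltNge; apply/negP => h4; nra.
Qed.

End doubling.

(** * Choice of constants and contradiction at small times *)

Lemma small_time_bound (R : realType) (n : nat) (alpha lambda sigma : R)
  (u : 'rV[R]_n -> R -> R) :
  (1 <= n)%N -> 0 < alpha < n%:R + 2 -> 0 < lambda ->
  0 <= sigma < 1 - (alpha - 2) / (n%:R + 2) * lambda ->
  (forall x t, 0 < t < 16 -> 0 <= u x t) -> C21_slab u ->
  (int_slab (fun y s => (powR (u y s) lambda)%:E) < +oo)%E ->
  (forall x t, enorm x < 4 -> 0 < t < 16 ->
     0 <= dt u x t - laplacian u x t /\
     ((dt u x t - laplacian u x t)%:E <=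
        int_slab (fun y s =>
          (powR (heat_kernel (x - y) (t - s)) (alpha / n%:R) * powR (u y s) lambda)%:E)
        * (powR (u x t) sigma)%:E)%E) ->
  forall e, 0 < e -> exists2 tau, 0 < tau <= 1 & forall x t, enorm x <= 1 ->
    0 < t < tau -> powR t ((n%:R + 2) / (2 * lambda)) * u x t <= e.
Proof.
move=> n0 alpha02 lam0 /andP[sig0 sig1] u0 Cu finN pde e e0.
have /andP[alpha0 alphan] := alpha02.
have nR : 1 <= n%:R :> R by rewrite (ler_nat _ 1).
pose phi s := int_Rn (fun y => (powR (u y s) lambda)%:E).
have phi0 s : (0 <= phi s)%E by apply: int_Rn_ge0 => y; rewrite lee_fin powR_ge0.
pose gamma := (n%:R + 2) / lambda.
have g0 : 0 < gamma by rewrite divr_gt0//; lra.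
have gl : gamma * lambda = n%:R + 2 by rewrite /gamma divfK// gt_eqF.
(* With M of order r^-gamma, the source is of order r^(-alpha - gamma sigma), the admissible size M
   / r^2 of order r^(-gamma - 2). [delta] is the gap between these exponents, and it is positive
   exactly by the bound on sigma. *)
pose delta := gamma + 2 - alpha - gamma * sigma.
have d0 : 0 < delta.
  have : gamma * sigma < gamma * (1 - (alpha - 2) / (n%:R + 2) * lambda).
    by rewrite ltr_pM2l.
  have -> : gamma * (1 - (alpha - 2) / (n%:R + 2) * lambda) = gamma - (alpha - 2).
    by rewrite /gamma; field; rewrite !gt_eqF//; lra.
  by rewrite /delta; lra.
pose k : R := 2 * powR 2 gamma.
have k1 : 1 <= k.
  have : powR 2 0 <= powR 2 gamma :> R by apply: ler_powR; [lra|exact: ltW].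
  by rewrite powRr0 /k; lra.
have [th /andP[th0 th1] lower] := interior_lower_bound k n0 k1.
have [C1 [C2 [C10 C20 pot]]] := @potential_bound R n alpha lambda n0 alpha02 lam0.
have [N N0 NE] : exists2 N, 0 <= N & int_slab (fun y s => (powR (u y s) lambda)%:E) = N%:E.
  have : (0 <= int_slab (fun y s => (powR (u y s) lambda)%:E))%E.
    by apply: integral_ge0 => s _; exact: phi0.
  by move: finN; case: int_slab => [N| |]//; exists N.
(* The outer radius will be sqrt t / 2, which costs 2^-gamma; [e2] is the value of r^gamma M that
   the doubling produces. *)
pose e1 := e * powR 2 (- gamma).
have e10 : 0 < e1 by rewrite mulr_gt0 ?powR_gt0.
pose e2 := e1 / 2 * powR 2 (- gamma).
have e20 : 0 < e2 by rewrite mulr_gt0 ?powR_gt0//; lra.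
pose kappa := k * e2.
have kappa0 : 0 < kappa by rewrite mulr_gt0//; lra.
(* The source will be at most C3 r^(-alpha - gamma sigma). For r < r1 one has (C3 + 1) r^delta <= 4
   kappa, which brings it below k M / (r / 2)^2; the added 1 keeps the divisor positive. *)
pose C3 := (C1 * powR kappa lambda * powR 2^-1 (n%:R + 2 - alpha)
  + C2 * powR 2^-1 (- alpha) * N) * powR kappa sigma.
have C30 : 0 <= C3 by rewrite mulr_ge0 ?addr_ge0 ?mulr_ge0 ?powR_ge0 ?(ltW C20).
pose r1 := powR (4 * kappa / (C3 + 1)) delta^-1.
have q0 : 0 < 4 * kappa / (C3 + 1) by rewrite divr_gt0 ?mulr_gt0//; lra.
have r10 : 0 < r1 by rewrite powR_gt0.
(* (M / 4)^lambda times the measure of a cylinder of side th r and duration th r^2 / 4, since the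
   lower bound is applied at radius r / 2. *)
pose mass := powR 4^-1 lambda * powR e2 lambda * th ^+ n * (th / 4).
have mass0 : 0 < mass.
  by rewrite !mulr_gt0 ?powR_gt0 ?exprn_gt0//; lra.
have [a /andP[a0 a16] Ia] : exists2 a, 0 < a <= 16 &
    (\int[lebesgue_measure]_(s in `]0%R, a[) phi s <= (mass / 2)%:E)%E.
  by apply: integral_small_interval => //; lra.
have ninv1 : n%:R^-1 <= 1 :> R by rewrite invf_le1 ?(lt_le_trans ltr01 nR).
(* The three bounds put the cylinder in times below [a], force r <= R0 < r1, and keep the cube of
   half side R0 about a point of the unit ball inside the ball of radius 4. *)
pose tau := Num.min (Num.min a (r1 ^+ 2)) n%:R^-1.
have tau0 : 0 < tau.
  by rewrite /tau !lt_min a0 exprn_gt0//= invr_gt0 (lt_le_trans ltr01 nR).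
have tau1 : tau <= 1.
  by rewrite /tau ge_min ninv1 orbT.
exists tau; first by rewrite tau0.
move=> x t x1 /andP[t0]; rewrite /tau !lt_min => /andP[/andP[ta tr1] tn].
have t1 : t < 1 by exact: lt_le_trans tn ninv1.
rewrite leNgt; apply/negP => big.
pose R0 := Num.sqrt t / 2.
have st0 : 0 < Num.sqrt t by rewrite sqrtr_gt0.
have R00 : 0 < R0 by rewrite divr_gt0.
have R2 : R0 ^+ 2 = t / 4.
  by rewrite /R0 expr_div_n sqr_sqrtr ?(ltW t0)//; congr (_ / _); ring.
have R0g : powR R0 gamma = powR t ((n%:R + 2) / (2 * lambda)) * powR 2 (- gamma).
  rewrite /R0 powRM ?(ltW st0) ?invr_ge0//; congr (_ * _).
    rewrite -powR12_sqrt ?(ltW t0)// -powRrM; congr powR.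
    by rewrite /gamma; field; rewrite gt_eqF.
  by rewrite -[2^-1]powR_inv1// -powRrM mulN1r.
have [|||y [s [r [/andP[r0 rR] M0 rM sub uM]]]] :=
    doubling u x t R0 gamma e1 Cu g0 R00 _ _ u0 e10 _.
- by rewrite R2; lra.
- by lra.
- by rewrite R0g mulrAC ltr_pM2r ?powR_gt0.
rewrite -/k -/e2 in rM uM.
set M := u y s in M0 rM uM.
have r20 : 0 < r ^+ 2 by rewrite exprn_gt0.
have rr1 : r < r1.
  rewrite -(@ltr_pXn2r _ 2) ?nnegrE ?(ltW r0) ?(ltW r10)//.
  apply: le_lt_trans tr1; apply: (@le_trans _ _ (R0 ^+ 2)).
    by rewrite lerXn2r ?nnegrE ?(ltW r0) ?(ltW R00).
  by rewrite R2; clear - t0; lra.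
have slab y' s' : in_cyl x t R0 y' s' -> 0 < s' < 16.
  move=> [_]; rewrite R2; clear - t0 t1 => /andP[? ?].
  by apply/andP; split; lra.
have ball4 y' s' : in_cyl x t R0 y' s' -> enorm y' < 4.
  move=> [hy _]; apply: (enorm_lt4 x y' x1) => i.
  have h2 : (y' ord0 i - x ord0 i) ^+ 2 <= R0 ^+ 2.
    by rewrite -[leLHS]real_normK ?num_real// lerXn2r ?nnegrE ?(ltW R00).
  apply: (@le_trans _ _ (n%:R * t)).
    rewrite ler_pM2l ?(lt_le_trans ltr01 nR)//.
    by move: h2; rewrite R2; clear - t0; lra.
  by rewrite mulrC -ler_pdivlMr ?div1r ?(ltW tn)// (lt_le_trans ltr01 nR).
have center := in_cyl_center y s r (ltW r0).
have corner := in_cyl_corner y s r (ltW r0).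
have /andP[s0 s16] := slab _ _ (sub _ _ center).
have /andP[s1 _] := slab _ _ (sub _ _ corner).
have st : s <= t by have [_ /andP[_]] := sub _ _ center.
have KE : k * M = kappa * powR r (- gamma).
  rewrite /kappa -rM powRN; have := powR_gt0 gamma r0.
  by set P := powR r gamma => P0; field; rewrite gt_eqF.
clearbody kappa; clearbody e2.
have r2 : 0 < r / 2 by rewrite divr_gt0.
have half1 y' s' : in_cyl y s (r / 2) y' s' -> in_cyl y s r y' s'.
  by move=> h; apply: (in_cyl_half_trans _ _ _ _ _ _ _ h); exact: in_cyl_center (ltW r2).
(* The potential is split along the cylinder of radius r / 2 ending at the point itself, which must
   stay where u <= k M; hence the estimate holds at half the radius. *)
have heat_le y' s' : in_cyl y s (r / 2) y' s' ->
    0 <= dt u y' s' - laplacian u y' s' <= k * M / (r / 2) ^+ 2.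
  move=> hc; have hc1 := half1 _ _ hc; have hc2 := sub _ _ hc1.
  have hs' := slab _ _ hc2.
  have [-> H /=] := pde y' s' (ball4 _ _ hc2) hs'.
  have K0 : 0 <= k * M by rewrite mulr_ge0 ?(ltW M0) ?(le_trans ler01 k1).
  have P := pot u y' s' (r / 2) (k * M) r2 K0 u0 _.
  have {}P := P (fun y'' s'' _ h => uM _ _ (in_cyl_half_trans _ _ _ _ _ _ _ hc h)).
  rewrite NE -EFinM -EFinD in P.
  rewrite -lee_fin; apply: (le_trans H).
  set A := (_ + _)%R in P.
  apply: (@le_trans _ _ (A%:E * (powR (k * M) sigma)%:E)%E).
    apply: lee_pmul => //.
    - by apply: integral_ge0 => s'' _; apply: int_Rn_ge0 => z; rewrite lee_fin mulr_ge0 ?powR_ge0.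
    - by rewrite lee_fin powR_ge0.
    - rewrite lee_fin; apply: ge0_ler_powR; rewrite ?nnegrE ?sig0 ?K0 ?(u0 _ _ hs')//.
      exact: uM.
  rewrite -EFinM lee_fin.
  have AE : A * powR (k * M) sigma = C3 * powR r (- alpha - gamma * sigma).
    rewrite /A KE !powRM ?invr_ge0 ?powR_ge0 ?(ltW r0) ?(ltW kappa0)// -!powRrM.
    have rD a' b' : powR r (a' + b') = powR r a' * powR r b'.
      by apply: powRD; rewrite (gt_eqF r0) implybT.
    rewrite !mulNr gl.
    rewrite (rD (n%:R + 2)) (rD (- alpha)) (powRN r (n%:R + 2)).
    have rn0 := powR_gt0 (n%:R + 2) r0.
    rewrite /C3; set X := powR r (n%:R + 2) in rn0 *.
    by field; rewrite gt_eqF.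
  rewrite AE KE.
  have -> : kappa * powR r (- gamma) / (r / 2) ^+ 2 = 4 * kappa * powR r (- gamma - 2).
    rewrite powRD ?(gt_eqF r0) ?implybT// powRN [powR r (- 2)]powRN powR_mulrn ?(ltW r0)//.
    by field; rewrite !gt_eqF ?powR_gt0.
  have -> : - alpha - gamma * sigma = delta + (- gamma - 2) by rewrite /delta; ring.
  rewrite [powR r (delta + _)]powRD ?(gt_eqF r0) ?implybT// mulrA.
  rewrite ler_wpM2r ?powR_ge0//.
  have : powR r delta <= powR r1 delta.
    by apply: ge0_ler_powR; rewrite ?nnegrE ?(ltW d0) ?(ltW r0) ?(ltW r10) ?(ltW rr1).
  rewrite /r1 -powRrM mulVf ?gt_eqF// powRr1 ?(ltW q0)// ler_pdivlMr; last by lra.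
  have := powR_ge0 r delta; set X := powR r delta => X0.
  by rewrite mulrDr mulr1 mulrC; clear - X0; lra.
have low := lower u y s (r / 2) M Cu _ M0 _ s16 _ erefl.
have E4 : (r / 2) ^+ 2 = r ^+ 2 / 4 by field.
have {}low (y' : 'rV[R]_n) s' : (forall i, `|y' ord0 i - y ord0 i| <= th * (r / 2)) ->
    s - th * (r ^+ 2 / 4) <= s' <= s -> M / 4 <= u y' s'.
  move=> hy hs; apply: low => //.
  - by rewrite E4; clear - s1 r20; lra.
  - move=> z w hz; split; last exact: heat_le.
    by rewrite uM ?u0 ?(slab _ _ (sub _ _ (half1 _ _ hz)))//; exact: half1.
  - by rewrite E4.
pose A := `[s - th * (r ^+ 2 / 4), s]%classic.
have thr : 0 < th * (r ^+ 2 / 4) by rewrite mulr_gt0// divr_gt0.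
have thr1 : th * (r ^+ 2 / 4) <= r ^+ 2 / 4 by rewrite ler_piMl// divr_ge0// ltW.
have muA : lebesgue_measure A = (th * (r ^+ 2 / 4))%:E.
  rewrite /A lebesgue_measure_itv/= lte_fin ltrBlDr ltrDl thr.
  by rewrite -EFinD; congr (_%:E); ring.
have thr2 : 0 < th * (r / 2) by rewrite mulr_gt0.
have lowint : ((powR (M / 4) lambda * (2 * (th * (r / 2))) ^+ n * (th * (r ^+ 2 / 4)))%:E
    <= \int[lebesgue_measure]_(s in `]0%R, a[) phi s)%E.
  apply: (@le_trans _ _ (\int[lebesgue_measure]_(s' in A)
      (cst (powR (M / 4) lambda * (2 * (th * (r / 2))) ^+ n)%:E) s')%E).
    rewrite integral_cst; last exact: measurable_itv.
    by rewrite [X in (_ * X)%E]muA.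
  apply: ge0_le_integral_nm => s'.
  - by move=> _; rewrite lee_fin mulr_ge0 ?powR_ge0 ?exprn_ge0// mulr_ge0// ltW.
  - by move=> _; exact: phi0.
  rewrite /A /= !in_itv/= => /andP[h1 h2]; split.
    by clear - h1 h2 thr1 s1 st ta r20; apply/andP; split; lra.
  apply: (int_Rn_box_ge n _ _ y) => //; first exact: powR_ge0.
    by move=> z; rewrite lee_fin powR_ge0.
  move=> z hz; rewrite lee_fin; have hl : M / 4 <= u z s' by apply: low => //; rewrite h1.
  have M40 : 0 <= M / 4 by rewrite divr_ge0// ltW.
  by apply: ge0_ler_powR; rewrite ?nnegrE ?(ltW lam0)// (le_trans M40).
have := le_trans lowint Ia; rewrite lee_fin.
(* As gamma lambda = n + 2, all powers of r cancel. *)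
have -> : powR (M / 4) lambda * (2 * (th * (r / 2))) ^+ n * (th * (r ^+ 2 / 4)) = mass.
  have -> : 2 * (th * (r / 2)) = th * r by field.
  have ME : M = e2 * powR r (- gamma).
    rewrite -rM powRN; have := powR_gt0 gamma r0.
    by set P := powR r gamma => P0; field; rewrite gt_eqF.
  rewrite ME !powRM ?invr_ge0 ?mulr_ge0 ?powR_ge0 ?(ltW e20)// -powRrM mulNr gl powRN exprMn.
  have -> : powR r (n%:R + 2) = r ^+ n * r ^+ 2.
    by rewrite powRD ?(gt_eqF r0) ?implybT// !powR_mulrn ?(ltW r0).
  rewrite /mass; have rn0 : 0 < r ^+ n by rewrite exprn_gt0.
  by field; rewrite !gt_eqF.
by clear - mass0; lra.
Qed.

Theorem theorem5p1 (R : realType) (n : nat) (alpha lambda sigma : R)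
  (u : 'rV[R]_n -> R -> R) :
  (1 <= n)%N ->
  0 < alpha < n%:R + 2 ->
  (n%:R + 2) / n%:R <= lambda ->
  0 <= sigma < 1 - (alpha - 2) / (n%:R + 2) * lambda ->
  (forall x t, 0 < t < 16 -> 0 <= u x t) ->
  C21_slab u ->
  Llambda_slab lambda u ->
  (forall x t, enorm x < 4 -> 0 < t < 16 ->
     0 <= dt u x t - laplacian u x t /\
     ((dt u x t - laplacian u x t)%:E <=
        int_slab (fun y s =>
          (powR (heat_kernel (x - y) (t - s)) (alpha / n%:R) * powR (u y s) lambda)%:E)
        * (powR (u x t) sigma)%:E)%E) ->
  (fun t => powR t ((n%:R + 2) / (2 * lambda)) * max_unit_ball u t) @ at_right 0
    --> 0.
Proof.
move=> n0 alpha02 lam sig u0 Cu fin pde.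
have nR : 1 <= n%:R :> R by rewrite (ler_nat _ 1).
have lam0 : 0 < lambda by apply: lt_le_trans lam; rewrite divr_gt0//; lra.
have finN : (int_slab (fun y s => (powR (u y s) lambda)%:E) < +oo)%E.
  apply: le_lt_trans fin; rewrite le_eqVlt; apply/orP; left; apply/eqP.
  apply: eq_integral => s; rewrite inE/= in_itv/= => hs.
  by congr int_Rn; apply/funext => y; rewrite ger0_norm// u0.
have main := small_time_bound R n alpha lambda sigma u n0 alpha02 lam0 sig u0 Cu finN pde.
apply/cvgr0Pnorm_le => e e0.
have [tau /andP[tau0 tau1] H] := main e e0.
near=> t.
have t0 : 0 < t by near: t; exact: nbhs_right_gt.
have tt : t < tau by near: t; exact: nbhs_right_lt.
have t16 : 0 < t < 16 by apply/andP; split; lra.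
have p0 : 0 < powR t ((n%:R + 2) / (2 * lambda)) by rewrite powR_gt0.
have z1 : enorm (0 : 'rV[R]_n) <= 1.
  rewrite /enorm big1 ?sqrtr0// => i _.
  by rewrite mxE expr0n.
have ub x : enorm x <= 1 -> u x t <= e / powR t ((n%:R + 2) / (2 * lambda)).
  by move=> x1; rewrite ler_pdivlMr// mulrC H// t0.
rewrite /max_unit_ball; set A := [set _ | _ in _].
(* The supremum is meaningful only for a nonempty set bounded above; the value at the origin also
   shows that it is nonnegative. *)
have A0 : A (u 0 t) by exists 0.
have hA : has_sup A.
  split; first by exists (u 0 t).
  by exists (e / powR t ((n%:R + 2) / (2 * lambda))) => _ [x /= x1 <-]; exact: ub.
have s0 : 0 <= sup A by apply: le_trans (sup_upper_bound hA A0); exact: u0.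
rewrite ger0_norm ?mulr_ge0 ?(ltW p0)// mulrC -ler_pdivlMr//.
by apply: ge_sup; [exists (u 0 t)|move=> _ [x /= x1 <-]; exact: ub].
Unshelve. all: by end_near. Qed.
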